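(* Let $\Gamma$ be a genus $0$ tropical curve that is rigid with respect to conditions $\mathbf{A},\Psi$. Then $$\mathfrak{D}_\Gamma=\frac{\prod_{V\in\Gamma^{[0]}}\mathrm{Mult}(V)}{\prod_{E\in\Gamma^{[1]}_c}\mathrm{Mult}(E)}.$$
   Context: **Lattices.** $N$ is a lattice of finite rank $r$, $N_{\mathbb{R}}=N\otimes\mathbb{R}$. For $S\subset N_{\mathbb{R}}$, $L(S)$ is the real span of all $u-v$ with $u,v\in S$, and $L_N(S)=L(S)\cap N$. **Tropical curves.** Let $\overline{\Gamma}$ be the topological realization of a finite connected graph, and $\Gamma$ the complement of some set of its univalent vertices. $\Gamma^{[0]},\Gamma^{[1]},\Gamma^{[1]}_\infty,\Gamma^{[1]}_c$ denote the vertices, edges, non-compact edges and compact edges of $\Gamma$; assume $\Gamma^{[0]}\neq\emptyset$. $\Gamma$ carries a weight function $w:\Gamma^{[1]}\to\mathbb{Z}_{\ge0}$, a genus function $g:\Gamma^{[0]}\to\mathbb{Z}_{\ge0}$ (positive at univalent and bivalent vertices) and a marking, i.e. a bijection $\epsilon:I\to\overline{\Gamma}^{[0]}\setminus\Gamma^{[0]}$; $E_i$ is the non-compact edge containing $\epsilon(i)$, and $I^\circ=\{i: w(E_i)=0\}$. A parameterized tropical curve also has a continuous map $h:\Gamma\to N_{\mathbb{R}}$ that is a proper embedding into an affine line of rational slope on each edge with $w(E)>0$, contracts each edge with $w(E)=0$ to a point, and is balanced: $\sum_{E\ni V}w(E)u_{(V,E)}=0$ for all $V\in\Gamma^{[0]}$,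 where $u_{(V,E)}$ is the primitive integral vector emanating from $h(V)$ into $h(E)$ (and $0$ if $h(E)$ is a point). Contracted compact edges have a length in $\mathbb{R}_{>0}$. A tropical curve is an isomorphism class (homeomorphisms respecting weights, genera, markings, $h$). Write $u_E$ for $u_{(V,E)}$ (up to sign) and $u_i$ for $u_{(\partial E_i,E_i)}$. The genus is $b_1(\Gamma)+\sum_Vg(V)$; the degree is $\Delta:I\to N$, $\Delta(i)=w(E_i)u_i$; the type $\mathfrak{u}$ is the marked weighted graph with genus function and the map $u:(V,E)\mapsto w(E)u_{(V,E)}$ on flags. Set $\mathrm{ov}(V)=\mathrm{val}(V)+3g(V)-3$, $\mathrm{ov}(\Gamma)=\sum_V\mathrm{ov}(V)$, $d^{\mathrm{trop}}_{g,\mathfrak{u}}=\#I+(r-3)(1-g)-\mathrm{ov}(\Gamma)$. A curve of type $\mathfrak{u}$ is non-superabundant if it has no contracted loops or higher-genus vertices and the space of curves of type $\mathfrak{u}$ has dimension $d^{\mathrm{trop}}_{g,\mathfrak{u}}$. **Constraints and rigidity.** An affine constraint $\mathbf{A}=(A_i)_{i\in I}$ is a tuple of rational-slope affine subspaces of $N_{\mathbb{R}}$. A curve matches $\mathbf{A}$ if $h(E_i)\subset A_i$ for all $i$; it satisfies $\Psi=(s_i)_{i\in I^\circ}\in\mathbb{Z}_{\ge0}^{I^\circ}$ if $\mathrm{ov}(V)\ge\sum_{i\in I^\circ,\,E_i\ni V}s_i$ for each $V$. $\mathfrak{T}_{g,\Delta}(\mathbf{A},\Psi)$ is the space of marked tropical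 curves of genus $g$, degree $\Delta$, matching $\mathbf{A}$ and satisfying $\Psi$. $\Gamma\in\mathfrak{T}_{g,\Delta}(\mathbf{A},\Psi)$ is rigid if $\mathbf{A}$ is generic (generic translates), $\Gamma$ is non-superabundant and $\sum_i\mathrm{codim}(A_i)=d^{\mathrm{trop}}_{g,\mathfrak{u}}$; then it is an isolated point. **The index $\mathfrak{D}_\Gamma$.** With $\partial^\pm E$ an arbitrary labelling of the endpoints of a compact edge and $L_N(E):=L_N(h(E))$, $\mathfrak{D}_\Gamma$ is the index of the (finite-index, for rigid $\Gamma$) map $$\Phi:\prod_{V\in\Gamma^{[0]}}N\to\prod_{E\in\Gamma_c^{[1]}}N/L_N(E)\times\prod_{i\in I}N/L_N(A_i),\quad H\mapsto((H_{\partial^+E}-H_{\partial^-E})_E,(H_{\partial E_i})_i).$$ **Edge and vertex multiplicities.** Let $E$ be a compact edge of the genus $0$ curve $\Gamma$, and let $\Gamma_1,\Gamma_2$ be the two genus $0$ tropical curves obtained by splitting $\Gamma$ at $E$ and extending the resulting half-edges to unbounded edges $E_1$ of $\Gamma_1$ and $E_2$ of $\Gamma_2$ (notation local to this paragraph). Equip $\Gamma_i$ with the conditions induced by $\mathbf{A},\Psi$, and impose the trivial condition $N_{\mathbb{R}}$ on the new edge $E_i$. Small deformations of $\Gamma_i$ still satisfying these conditions translate $E_i$; the translates of $E_i$ sweep out a patch of an affine linear space, and $W_{E_i}\subset N$ denotes the intersection of the corresponding linear space with $N$. By rigidity $W_{E_1}\cap W_{E_2}\subseteq\mathbb{Z}u_E$.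 Define $$\mathrm{Mult}(E)=\mathrm{index}\big(N/\mathbb{Z}u_E\to(N/W_{E_1})\oplus(N/W_{E_2})\big).$$ For a vertex $V$ define $$\mathrm{Mult}(V)=\mathrm{index}\Big(N\to\prod_{E\ni V}N/W_{\partial_VE,E}\Big),$$ where for a compact edge $E\ni V$, $W_{\partial_VE,E}$ is the lattice $W_{E_i}$ associated to the component of $\Gamma\setminus E$ not containing $V$, and for a non-compact edge $E_i\ni V$, $W_{\partial_VE_i,E_i}:=L_N(A_i)$. Here index means the order of the cokernel. *)

(* Defs.v *)
From HB Require Import structures.
From mathcomp Require Import all_boot all_order all_algebra.
From mathcomp Require Import finmap boolp classical_sets functions cardinality reals.

Set Implicit Arguments.
Unset Strict Implicit.
Unset Printing Implicit Defensive.

Import Order.TTheory GRing.Theory Num.Theory.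

Local Open Scope classical_set_scope.
Local Open Scope ring_scope.

(* The lattice N of rank r is 'rV[int]_r, and N_R is 'rV[R]_r. *)

Definition toR (R : realType) m n (M : 'M[int]_(m, n)) : 'M[R]_(m, n) :=
  map_mx (fun z : int => z%:~R) M.

(* L(S): the real span of all differences u - v with u, v in S. *)
Definition lin_span (R : realType) (W : lmodType R) (S : set W) : set W :=
  [set x | exists k (a : 'I_k -> R) (u v : 'I_k -> W),
     (forall i, S (u i) /\ S (v i)) /\ x = \sum_i a i *: (u i - v i)].

(* L_N(S) = L(S) /\ N *)
Definition lat_span (R : realType) r (S : set 'rV[R]_r) : set 'rV[int]_r :=
  [set n | lin_span S (toR R n)].

Definition has_affine_dim (R : realType) (W : vectType R) (S : set W)
    (d : nat) : Prop :=
  exists2 U : {vspace W}, (forall x, x \in U <-> lin_span S x) & \dim U = d.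

Definition primitive r (u : 'rV[int]_r) : Prop :=
  forall (k : int) (v : 'rV[int]_r), u = k *: v -> `|k| = 1.

(* The cokernel of the map G -> \prod_j N / K_j induced by f, as the set of
   its elements, each being a class in \prod_j N.  [coker_index f K] is its order
   (with value 0 when the cokernel is infinite). *)
Definition coker (G J : Type) (N : zmodType) (f : G -> J -> N)
    (K : J -> set N) : set (set (J -> N)) :=
  range (fun y : J -> N =>
    [set y' | exists x, forall j, K j (y' j - y j - f x j)]).

Definition coker_index (G J : Type) (N : zmodType) (f : G -> J -> N)
    (K : J -> set N) : nat :=
  (#|` fset_set (coker f K)|)%fset.

(* Combinatorial types.  The vertices and compact edges of Gamma are [tvert]
   and [tedge]; the marking identifies the non-compact edges with I (each of
   them has exactly one vertex [tleg i], since Gamma has a vertex and is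
   connected).  A compact edge e has endpoints [tend e false] and
   [tend e true], which may coincide; [uedge e] is the direction u_(V,E) at
   the endpoint [tend e false]. *)
Record trop_type (r : nat) (I : finType) := TropType {
  tvert : finType;
  tedge : finType;
  tend : tedge -> bool -> tvert;
  tleg : I -> tvert;
  ewt : tedge -> nat;
  lwt : I -> nat;
  tgen : tvert -> nat;
  uedge : tedge -> 'rV[int]_r;
  uleg : I -> 'rV[int]_r }.

Section TropicalTypes.
Variables (r : nat) (I : finType) (T : trop_type r I).

Definition flag : finType := ((tedge T * bool) + I)%type.

Definition fvert (f : flag) : tvert T :=
  match f with inl (e, b) => tend e b | inr i => tleg T i end.

Definition fwt (f : flag) : nat :=
  match f with inl (e, _) => ewt e | inr i => lwt T i end.

Definition fdir (f : flag) : 'rV[int]_r :=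
  match f with
  | inl (e, b) => if b then - uedge e else uedge e
  | inr i => uleg T i
  end.

(* Adjacency using only the compact edges in F. *)
Definition adj (F : {set tedge T}) : rel (tvert T) :=
  [rel x y | [exists e in F, exists b, (tend e b == x) && (tend e (~~ b) == y)]].

(* First Betti number of the subgraph formed by all the vertices and the
   compact edges in F; the subtraction never truncates. *)
Definition betti (F : {set tedge T}) : nat :=
  (#|F| + n_comp (adj F) (tvert T) - #|tvert T|)%N.

Definition genus : nat := (betti [set: tedge T]%SET + \sum_v tgen (t := T) v)%N.

Definition valence (v : tvert T) : nat := #|[pred f | fvert f == v]|.

Definition ov (v : tvert T) : int := (valence v)%:Z + (3 * tgen v)%:Z - 3.

Definition ov_total : int := \sum_v ov v.

Definition degree (i : I) : 'rV[int]_r := uleg T i *+ lwt T i.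

Definition dtrop : int :=
  #|I|%:Z + (r%:Z - 3) * (1 - genus%:Z) - ov_total.

(* The conditions on a type: Gamma is connected with a vertex, univalent and
   bivalent vertices have positive genus, directions are primitive on the
   edges of positive weight and zero on the others, and balancing holds. *)
Definition is_trop_type : Prop :=
  [/\ (0 < #|tvert T|)%N,
      forall x y, connect (adj [set: tedge T]%SET) x y,
      forall v, (0 < valence v <= 2)%N -> (0 < tgen v)%N,
      forall f, if (0 < fwt f)%N then primitive (fdir f) else fdir f = 0 &
      forall v, \sum_(f | fvert f == v) fdir f *+ fwt f = 0].

(* The psi-conditions s : only the values s i with i in I°, i.e. w(E_i) = 0,
   are used. *)
Definition satisfies_psi (s : I -> nat) : Prop :=
  forall v, (\sum_(i | (tleg T i == v) && (lwt T i == 0%N)) s i)%:Z <= ov v.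

End TropicalTypes.

(* An affine subspace of rational slope: the point [apt A] plus the real row
   span of the integral matrix [adir A]. *)
Record rat_affine (R : realType) (r : nat) := RatAffine {
  apt : 'rV[R]_r;
  adir : 'M[int]_r }.

Definition aset (R : realType) r (A : rat_affine R r) : set 'rV[R]_r :=
  [set apt A + y *m toR R (adir A) | y in [set: 'rV[R]_r]].

Definition acodim (R : realType) r (A : rat_affine R r) : nat :=
  (r - \rank (toR R (adir A)))%N.

Definition atranslate (R : realType) r (a : 'rV[R]_r) (A : rat_affine R r) :=
  RatAffine (apt A + a) (adir A).

Definition awhole (R : realType) r : rat_affine R r := RatAffine 0 1%:M.

(* A parameterized curve of type T is, up to isomorphism, given by the
   positions h(V) of the vertices and the lengths of the compact edges (which
   are lattice lengths for the edges of positive weight, and abstract lengths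
   for the contracted ones). *)
Definition config (R : realType) r (I : finType) (T : trop_type r I) :=
  ({ffun tvert T -> 'rV[R]_r} * {ffun tedge T -> R^o})%type.

Section Curves.
Variables (R : realType) (r : nat) (I : finType) (T : trop_type r I).
Implicit Types (c : config R T) (A : I -> rat_affine R r).

Definition curves_of_type : set (config R T) :=
  [set c : config R T | forall e : tedge T,
     0 < (c.2 e : R) /\
     c.1 (tend e true) = c.1 (tend e false) + (c.2 e : R) *: toR R (uedge e)].

Definition tropical_curve c : Prop := is_trop_type T /\ curves_of_type c.

Definition edge_image c (e : tedge T) : set 'rV[R]_r :=
  [set x | exists2 t : R, 0 <= t <= 1 &
     x = (1 - t) *: c.1 (tend e false) + t *: c.1 (tend e true)].

Definition leg_image c (i : I) : set 'rV[R]_r :=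
  [set x | exists2 t : R, 0 <= t &
     x = c.1 (tleg T i) + t *: toR R (uleg T i)].

Definition matches A c : Prop := forall i, leg_image c i `<=` aset (A i).

(* (T, c) lies in the space of curves of genus g and degree Delta matching A
   and satisfying s. *)
Definition in_moduli (g : nat) (Delta : I -> 'rV[int]_r) A (s : I -> nat) c :
    Prop :=
  [/\ tropical_curve c, genus T = g, degree T =1 Delta, matches A c &
      satisfies_psi T s].

(* The translation vectors a such that A + a is matched by a curve of type T:
   the image of the evaluation map, pulled back to \prod_i N_R. *)
Definition ev_translates A : set {ffun I -> 'rV[R]_r} :=
  [set a | exists2 c, curves_of_type c
                    & matches (fun i => atranslate (a i) (A i)) c].

Definition no_contracted_loops : Prop :=
  betti [set e : tedge T | ewt e == 0%N]%SET = 0%N.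

End Curves.

Definition non_superabundant (R : realType) r (I : finType)
    (T : trop_type r I) : Prop :=
  [/\ no_contracted_loops T, forall v : tvert T, tgen v = 0%N &
      exists2 d, has_affine_dim (curves_of_type (R := R) (T := T)) d & d%:Z = dtrop T].

(* Genericity of the translates: A lies on the evaluation image of no type
   (of genus g and degree Delta, satisfying the psi-conditions) whose image
   is contained in a proper affine subspace of the space of translates.
   There are finitely many types, so this excludes a finite union of proper
   affine subspaces. *)
Definition generic (R : realType) r (I : finType) (g : nat)
    (Delta : I -> 'rV[int]_r) (A : I -> rat_affine R r) (s : I -> nat) : Prop :=
  forall (T : trop_type r I) (c : config R T),
    in_moduli g Delta A s c -> lin_span (ev_translates T A) = [set: _].

Definition rigid (R : realType) r (I : finType) (A : I -> rat_affine R r)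
    (s : I -> nat) (T : trop_type r I) (c : config R T) : Prop :=
  [/\ in_moduli (genus T) (degree T) A s c,
      generic (genus T) (degree T) A s,
      non_superabundant R T &
      (\sum_i acodim (A i))%:Z = dtrop T].

(* Splitting at a compact edge e and keeping the component that contains
   [tend e b], with the half-edge of e at that endpoint extended to a new
   unbounded edge, marked by None. *)
Section Cut.
Variables (R : realType) (r : nat) (I : finType) (T : trop_type r I).
Variables (e : tedge T) (b : bool).

Definition side : {set tvert T} :=
  [set v | connect (adj (~: [set e]))%SET (tend e b) v]%SET.

Lemma tend_side : tend e b \in side.
Proof. by rewrite inE connect0. Qed.

Definition cut_vert : finType := {v : tvert T | v \in side}.

Definition cut_edge : finType :=
  {e' : tedge T | (e' != e) && [forall b', tend e' b' \in side]}.

Definition cut_mark : finType := {i : I | tleg T i \in side}.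

Lemma cut_edgeP (e' : cut_edge) b' : tend (val e') b' \in side.
Proof. by case/andP: (valP e') => _ /forallP. Qed.

Definition cut_type : trop_type r (option cut_mark) :=
  @TropType r (option cut_mark) cut_vert cut_edge
    (fun e' b' => exist _ (tend (val e') b') (cut_edgeP e' b'))
    (fun o => match o with
              | Some i => exist _ (tleg T (val i)) (valP i)
              | None => exist _ (tend e b) tend_side
              end)
    (fun e' => ewt (val e'))
    (fun o => match o with Some i => lwt T (val i) | None => ewt e end)
    (fun v => tgen (val v))
    (fun e' => uedge (val e'))
    (fun o => match o with
              | Some i => uleg T (val i)
              | None => fdir (inl (e, b) : flag T)
              end).

Definition cut_config (c : config R T) : config R cut_type :=
  ([ffun v : cut_vert => c.1 (val v)], [ffun e' : cut_edge => c.2 (val e')]).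

Definition cut_constraint (A : I -> rat_affine R r) (o : option cut_mark) :
    rat_affine R r :=
  match o with Some i => A (val i) | None => awhole R r end.

Definition cut_psi (s : I -> nat) (o : option cut_mark) : nat :=
  match o with Some i => s (val i) | None => 0%N end.

End Cut.

Definition close (R : realType) r (I : finType) (T : trop_type r I) (eps : R)
    (c c' : config R T) : Prop :=
  (forall v j, `|c'.1 v 0 j - c.1 v 0 j| < eps) /\
  (forall e, `|(c'.2 e : R) - c.2 e| < eps).

Section Multiplicities.
Variables (R : realType) (r : nat) (I : finType) (T : trop_type r I).
Variables (A : I -> rat_affine R r) (s : I -> nat) (c : config R T).

(* The part of N_R swept out by the translates of the new unbounded edge under
   the eps-small deformations of the component of Gamma \ e that contains
   [tend e b].  Deformations move the curve within its combinatorial type. *)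
Definition sweep (e : tedge T) (b : bool) (eps : R) : set 'rV[R]_r :=
  [set x | exists c' : config R (cut_type e b),
     [/\ curves_of_type c', close eps (cut_config e b c) c',
         matches (cut_constraint A) c',
         satisfies_psi (cut_type e b) (cut_psi s) &
         leg_image c' None x]].

(* The sets [sweep e b eps] decrease with eps, so the intersection below is
   the value of their lattice span for small eps. *)
Definition W_edge (e : tedge T) (b : bool) : set 'rV[int]_r :=
  \bigcap_(eps in [set eps : R | 0 < eps]) lat_span (sweep e b eps).

(* The source N / Z u_E of the map defining Mult(E) may be replaced by N, as
   this does not change the image. *)
Definition mult_edge (e : tedge T) : nat :=
  coker_index (fun (n : 'rV[int]_r) (_ : bool) => n) (W_edge e).

(* At a flag on a compact edge, the component of Gamma \ E away from the
   vertex is the one at the opposite endpoint. *)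
Definition W_flag (f : flag T) : set 'rV[int]_r :=
  match f with
  | inl (e, b) => W_edge e (~~ b)
  | inr i => lat_span (aset (A i))
  end.

Definition mult_vertex (v : tvert T) : nat :=
  coker_index (fun (n : 'rV[int]_r) (_ : {f : flag T | fvert f == v}) => n)
              (fun f => W_flag (val f)).

Definition Phi (H : tvert T -> 'rV[int]_r) (j : tedge T + I) : 'rV[int]_r :=
  match j with
  | inl e => H (tend e true) - H (tend e false)
  | inr i => H (tleg T i)
  end.

Definition D_index : nat :=
  coker_index Phi (fun j => match j with
                      | inl e => lat_span (edge_image c e)
                      | inr i => lat_span (aset (A i))
                      end).

End Multiplicities.

(* Main.v *)
(* Everything is an index of lattices. Write N for the lattice, W_(E,V) for the
   group attached to a flag (the one of the far side of E, or L_N(A_i)), and let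
   both maps below go from prod_V N to the product of the N/W_(E,V) over flags:
     Psi (H) has coordinate H_V,
     Theta (H) has coordinate H_V - H_V' at a compact edge E = VV' and H_V at a leg.
   Psi is the product over V of the maps defining Mult(V), so its index is
   prod_V Mult(V). Rigidity makes the real version of Phi bijective, whence
   W_(E,V) /\ W_(E,V') = Z u_E; so Theta is Phi followed by the injections
   N/Z u_E -> N/W_(E,V) + N/W_(E,V') (up to signs) and its index is
   D * prod_E Mult(E). Finally Theta is turned into Psi one coordinate at a time.
   If all coordinates but that of (E,V) vanish, then H_V' lies in W_(E,V), by
   induction from the leaves on the far side of E; hence the change of that
   coordinate alters neither the intersection of the image with the factor
   N/W_(E,V) nor its projection to the other factors, and the index is the same. *)

From HB Require Import structures.
Require Import Defs.
From mathcomp Require Import all_boot all_order all_algebra.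
From mathcomp Require Import boolp classical_sets functions cardinality reals.
From mathcomp Require Import zify ring lra.

Set Implicit Arguments.
Unset Strict Implicit.
Unset Printing Implicit Defensive.

Import Order.TTheory GRing.Theory Num.Theory.

Local Open Scope classical_set_scope.
Local Open Scope ring_scope.

(** * Finite index *)

Definition subgroup (B : zmodType) (S : set B) : Prop :=
  S 0 /\ forall x y, S x -> S y -> S (x - y).

(** A transversal with [n] elements stands in for the quotient group: it records finiteness of the
    index and its value at once. *)
Definition indexed (B : zmodType) (S : set B) (n : nat) : Prop :=
  exists rep : 'I_n -> B, forall y, exists! i, S (y - rep i).

Section Subgroups.
Variables (B : zmodType) (S : set B).
Hypothesis gS : subgroup S.

Lemma subgroup0 : S 0. Proof. by case: gS. Qed.

Lemma subgroupB x y : S x -> S y -> S (x - y). Proof. by case: gS => _; apply. Qed.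

Lemma subgroupN x : S x -> S (- x).
Proof. by move=> Sx; rewrite -sub0r; apply: subgroupB => //; apply: subgroup0. Qed.

Lemma subgroupD x y : S x -> S y -> S (x + y).
Proof. by move=> Sx Sy; rewrite -[y]opprK; apply/subgroupB/subgroupN. Qed.

Lemma subgroupMn x m : S x -> S (x *+ m).
Proof.
move=> Sx; elim: m => [|m IHm]; first by rewrite mulr0n; apply: subgroup0.
by rewrite mulrS; apply: subgroupD.
Qed.

Lemma subgroup_sum (J : Type) (s : seq J) (P : pred J) (F : J -> B) :
  (forall j, P j -> S (F j)) -> S (\sum_(j <- s | P j) F j).
Proof.
by move=> SF; elim/big_rec: _ => [|j y Pj Sy]; [apply: subgroup0|apply/subgroupD/Sy/SF].
Qed.

Lemma subgroup_sym x y : S (x - y) -> S (y - x).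
Proof. by move=> Sxy; rewrite -opprB; apply: subgroupN. Qed.

Lemma subgroup_trans y x z : S (x - y) -> S (y - z) -> S (x - z).
Proof. by move=> Sxy Syz; rewrite -(subrKA y); apply: subgroupD. Qed.

Lemma indexed_leq n m : indexed S n -> indexed S m -> (n <= m)%N.
Proof.
case=> rn hn [rm hm].
have /boolp.choice [f Sf] : forall i, exists j, S (rn i - rm j).
  by move=> i; have [j [Sj _]] := hm (rn i); exists j.
suff inj_f : injective f by have := leq_card f inj_f; rewrite !card_ord.
move=> i i' eqf; have [k [_ uk]] := hn (rn i).
rewrite -(uk i) ?subrr; last exact: subgroup0.
apply: uk; apply: (@subgroup_trans (rm (f i))); first exact: Sf.
by rewrite eqf; apply/subgroup_sym/Sf.
Qed.

Lemma indexed_uniq n m : indexed S n -> indexed S m -> n = m.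
Proof. by move=> Sn Sm; apply/eqP; rewrite eqn_leq !indexed_leq. Qed.

Lemma indexed_gt0 n : indexed S n -> (0 < n)%N.
Proof. by case=> rep /(_ 0) [i _]; apply: leq_ltn_trans (ltn_ord i). Qed.

Lemma indexed_fin (Q : finType) (rep : Q -> B) :
  (forall y, exists! i, S (y - rep i)) -> indexed S #|Q|.
Proof.
move=> hrep; exists (rep \o enum_val) => y; have [q [Sq uq]] := hrep y.
exists (enum_rank q); split=> [|i Si] /=; first by rewrite enum_rankK.
by rewrite (uq _ Si) enum_valK.
Qed.

(** The points [t i] meet every coset, possibly several times; keeping one canonical point per coset
    leaves a transversal. *)
Lemma indexed_cover (Q : finType) (t : Q -> B) :
  (forall y, exists i, S (y - t i)) -> exists n, indexed S n.
Proof.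
move=> cov; pose e i j : bool := `[< S (t i - t j) >].
pose can i := odflt i [pick j | e i j].
have ecan i : S (t i - t (can i)).
  rewrite /can; case: pickP => [j /asboolP //|/(_ i) /asboolP []].
  by rewrite subrr; apply: subgroup0.
have can_eq i j : S (t i - t j) -> can i = can j.
  move=> Sij; have eq_e : e i =1 e j.
    move=> k; apply/asboolP/asboolP; apply: subgroup_trans => //.
    exact: subgroup_sym.
  rewrite /can (eq_pick eq_e); case: pickP => //= /(_ j) /asboolP [].
  by rewrite subrr; apply: subgroup0.
pose Q' := {i : Q | can i == i}.
exists #|{: Q'}|; apply: (@indexed_fin _ (t \o val)) => y; have [i Si] := cov y.
have can_can : can (can i) == can i by apply/eqP/can_eq/subgroup_sym/ecan.
exists (exist _ (can i) can_can : Q'); split=> [|[j /= jP] Sj].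
  exact: subgroup_trans Si (ecan i).
apply/val_inj => /=; rewrite -(eqP jP); apply: can_eq.
by apply: subgroup_trans Sj; apply: subgroup_sym.
Qed.

End Subgroups.

(** The preimage, in the full product, of the image of [f] in the product of the [N / K j]; its
    cosets are the elements of the cokernel. *)
Definition image_plus (G J : Type) (N : zmodType) (f : G -> J -> N)
    (K : J -> set N) : set (J -> N) :=
  [set y | exists x, forall j, K j (y j - f x j)].

Lemma indexed_coker (G J : Type) (N : zmodType) (f : G -> J -> N)
    (K : J -> set N) (n : nat) :
  subgroup (image_plus f K) -> indexed (image_plus f K) n -> coker_index f K = n.
Proof.
set S := image_plus f K => gS [rep hrep]; apply: card_fset_set.
have cokE : coker f K = (fun i : 'I_n => [set y' | S (y' - rep i)]) @` setT.
  apply/seteqP; split=> _ [y _ <-].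
    have [i [Si _]] := hrep y; exists i => //.
    apply/seteqP; split=> y' Sy'.
      have [x xP] : S (y' - y) by apply: (subgroup_trans gS Sy'); apply: subgroup_sym.
      by exists x.
    change (S (y' - rep i)); apply: (subgroup_trans gS _ Si).
    by case: Sy' => x xP; exists x.
  by exists (rep y).
rewrite cokE; apply: (card_eq_trans (B := [set: 'I_n])).
  apply: inj_card_eq => i j _ _ eq_ij; have [k [_ uk]] := hrep (rep i).
  have Sii : S (rep i - rep i) by rewrite subrr; apply: subgroup0.
  rewrite -(uk i) //; apply: uk.
  by have /= := congr1 (fun X : set _ => X (rep i)) eq_ij => <-.
by rewrite card_eq_sym card_II.
Qed.

Lemma subgroup_image_plus (G N : zmodType) (J : Type) (f : G -> J -> N) (K : J -> set N) :
  {morph f : x y / x - y} -> (forall j, subgroup (K j)) -> subgroup (image_plus f K).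
Proof.
move=> fB gK; split=> [|y z [x xP] [x' xP']].
  have f0 : f 0 = 0 by rewrite -[0 in LHS](subrr 0) fB subrr.
  by exists 0 => j; rewrite f0 subrr; apply: subgroup0.
exists (x - x') => j; rewrite fB /=.
rewrite (_ : _ - _ = (y j - f x j) - (z j - f x' j)); first exact: subgroupB.
by rewrite !opprB addrACA [RHS]addrACA [- z j + _]addrC.
Qed.

Lemma fct_subE (X : Type) (M : zmodType) (f g : X -> M) x : (f - g) x = f x - g x.
Proof. by []. Qed.

(** * The index under homomorphisms and products *)

Section Comparison.
Variables (Z B : zmodType) (g : Z -> B).
Hypothesis gB : {morph g : x y / x - y}.

(** [Z] modulo the preimage embeds in [B / S], so one point chosen over each coset of [S] that meets
    the image of [g] suffices. *)
Lemma indexed_preim (S : set B) n :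
  subgroup S -> indexed S n -> exists m, indexed (g @^-1` S) m.
Proof.
move=> gS [rep hrep].
have /boolp.choice [t tP] : forall i, exists z, (exists z', S (g z' - rep i)) -> S (g z - rep i).
  move=> i; have [[z' Sz']|no] := pselect (exists z', S (g z' - rep i)); first by exists z'.
  by exists 0 => /no.
have gP : subgroup (g @^-1` S).
  split=> [|x y Sx Sy] /=; last by rewrite gB; apply: subgroupB.
  by rewrite -(subrr 0) gB subrr; apply: subgroup0.
apply: (@indexed_cover _ _ gP _ t) => z; have [i [Si _]] := hrep (g z).
exists i; rewrite /preimage /= gB; apply: (subgroup_trans gS Si).
by apply/(subgroup_sym gS)/tP; exists z.
Qed.

(** The index is multiplicative along 0 -> Z / g^-1(S) -> B / S -> B / (S + g(Z)) -> 0. *)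
Lemma indexed_comp (S : set B) n m :
  subgroup S -> indexed (g @^-1` S) n -> indexed [set y | exists z, S (y - g z)] m ->
  indexed S (m * n).
Proof.
move=> gS [rz hz] [rb hb].
rewrite -[m]card_ord -[n]card_ord -card_prod.
pose rep (p : 'I_m * 'I_n) := rb p.1 + g (rz p.2).
apply: (@indexed_fin _ _ _ rep) => y.
have [i [[z Sz] ui]] := hb y; have [j [Sj uj]] := hz z.
exists (i, j); split=> [|[i' j'] /= Sij'].
  rewrite /rep /= opprD addrA; apply: (subgroup_trans gS Sz).
  by rewrite -gB.
rewrite /rep /= opprD addrA in Sij'.
have Ei : i = i' by apply: ui; exists (rz j').
subst i'; congr pair; apply: uj; rewrite /preimage /= gB.
by apply: (subgroup_trans gS _ Sij'); apply: subgroup_sym.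
Qed.

(** By [indexed_comp] both indices are the product of the same two numbers, the indices of the
    common preimage and of the common sum. *)
Lemma indexed_exchange (S S' : set B) n :
  subgroup S -> subgroup S' -> g @^-1` S = g @^-1` S' ->
  [set y | exists z, S (y - g z)] = [set y | exists z, S' (y - g z)] ->
  indexed S n -> indexed S' n.
Proof.
move=> gS gS' eq_pre eq_sum Sn; have [p Sp] := indexed_preim gS Sn.
have [q Sq] : exists q, indexed [set y | exists z, S (y - g z)] q.
  case: Sn => rep hrep; apply: (@indexed_cover _ _ _ _ rep).
    split=> [|x y [z Sz] [z' Sz']] /=.
      by exists 0; rewrite sub0r -[0]subr0 gB subrr oppr0; apply: subgroup0.
    exists (z - z'); rewrite gB.
    have -> : x - y - (g z - g z') = (x - g z) - (y - g z').
      by rewrite !opprB addrACA [RHS]addrACA [- y + _]addrC.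
    exact: subgroupB.
  by move=> y; have [i [Si _]] := hrep y; exists i; exists 0; rewrite -[0]subr0 gB subrr subr0.
rewrite (indexed_uniq gS Sn (indexed_comp gS Sp Sq)).
by apply: indexed_comp; rewrite -?eq_pre -?eq_sum.
Qed.

End Comparison.

(** Representatives are lifts, provided by joint surjectivity of the [rho a], of tuples of
    representatives. *)
Lemma indexed_prod (B : zmodType) (A : finType) (Ba : A -> zmodType)
    (rho : forall a, B -> Ba a) (S : forall a, set (Ba a)) (n : A -> nat) :
  (forall a, {morph rho a : x y / x - y}) ->
  (forall w : forall a, Ba a, exists y, forall a, rho a y = w a) ->
  (forall a, indexed (S a) (n a)) ->
  indexed [set y | forall a, S a (rho a y)] (\prod_a n a).
Proof.
move=> rhoB glue Sn.
have /all_tag [rep hrep] : forall a, {rep : 'I_(n a) -> Ba a &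
    forall y, exists! i, S a (y - rep i)}.
  by move=> a; apply: cid; exact: Sn.
have /boolp.choice [t tP] : forall q : {dffun forall a, 'I_(n a)}, exists y, forall a,
    rho a y = rep a (q a).
  by move=> q; apply: glue.
have -> : (\prod_a n a)%N = #|{dffun forall a, 'I_(n a)}|.
  rewrite card_dep_ffun foldrE big_map big_enum.
  by apply: eq_bigr => a _; rewrite card_ord.
apply: (@indexed_fin _ _ _ t) => y.
have /all_tag [q hq] : forall a, {i : 'I_(n a) | S a (rho a y - rep a i) /\
    forall j, S a (rho a y - rep a j) -> i = j}.
  by move=> a; apply: cid; exact: hrep.
exists [ffun a => q a]; split=> [a|p Sp].
  by rewrite rhoB tP ffunE; case: (hq a).
apply/ffunP => a; rewrite ffunE; have [_] := hq a; apply.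
by have := Sp a; rewrite rhoB tP.
Qed.

Lemma indexed_factor (B : zmodType) (A : Type) (Ba : A -> zmodType)
    (rho : forall a, B -> Ba a) (S : forall a, set (Ba a)) n a :
  (forall a, {morph rho a : x y / x - y}) ->
  (forall w : Ba a, exists y, rho a y = w) -> subgroup (S a) ->
  indexed [set y | forall a, S a (rho a y)] n -> exists m, indexed (S a) m.
Proof.
move=> rhoB rho_surj gS [rep hrep].
apply: (@indexed_cover _ _ gS _ (fun i => rho a (rep i))) => w.
have [y <-] := rho_surj w; have [i [Si _]] := hrep y.
by exists i; rewrite -rhoB.
Qed.

(* The two subgroups have the same intersection with the k-th factor and the same
   sum with it, so [indexed_exchange] applies. *)
Lemma indexed_swap (G N : zmodType) (J : eqType) (f f' : G -> J -> N) (K : J -> set N) k n :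
  {morph f : x y / x - y} -> {morph f' : x y / x - y} -> (forall j, subgroup (K j)) ->
  (forall x j, j != k -> f x j = f' x j) ->
  (forall x, (forall j, j != k -> K j (f x j)) -> K k (f x k - f' x k)) ->
  indexed (image_plus f K) n -> indexed (image_plus f' K) n.
Proof.
move=> fB f'B gK agree diff.
pose g (z : N) (j : J) : N := if j == k then z else 0.
have gB : {morph g : x y / x - y}.
  by move=> x y; apply/funext => j; rewrite /g -[RHS]/(_ - _); case: eqP; rewrite ?subr0.
have subE y z j : (y - g z) j = y j - if j == k then z else 0 by [].
have [gS gS'] : subgroup (image_plus f K) /\ subgroup (image_plus f' K).
  by split; apply: subgroup_image_plus.
have KN j x : K j (- x) -> K j x.
  by move=> Kx; rewrite -[x]opprK; apply: subgroupN.
apply: (indexed_exchange gB gS gS').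
  (* Intersection with the k-th factor: the other coordinates of [f x] lie in the [K j], so by
     [diff] the values [f x k] and [f' x k] are interchangeable. *)
  apply/seteqP; split=> z [x xP]; exists x => j.
    have := xP j; rewrite /g; case: eqP => [->|/eqP nk]; last by rewrite agree.
    move=> Kx; rewrite -[z](subrK (f x k)) -addrA; apply: subgroupD => //.
    apply: diff => j' nj'; apply: KN; rewrite -sub0r.
    by have := xP j'; rewrite /g (negbTE nj').
  have := xP j; rewrite /g; case: eqP => [->|/eqP nk]; last by rewrite agree.
  move=> Kx; rewrite -[z](subrK (f' x k)) -addrA; apply: subgroupD => //.
  apply: (subgroup_sym (gK k)); apply: diff => j' nj'; apply: KN; rewrite -sub0r agree //.
  by have := xP j'; rewrite /g (negbTE nj').
(* Sum with the k-th factor: the k-th coordinate is free, and the new [z] is chosen to make its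
   remainder zero. *)
apply/seteqP; split=> y [z [x xP]].
  exists (y k - f' x k), x => j; rewrite subE.
  have := xP j; rewrite subE; case: eqP => [->|/eqP nk]; last by rewrite agree.
  by rewrite subKr subrr => _; apply: subgroup0.
exists (y k - f x k), x => j; rewrite subE.
have := xP j; rewrite subE; case: eqP => [->|/eqP nk]; last by rewrite agree.
by rewrite subKr subrr => _; apply: subgroup0.
Qed.

(** A finitely generated torsion group is finite: one [M] kills the unit vectors modulo [S], hence
    everything, and the vectors with entries from 0 to M - 1 meet all cosets. *)
Lemma indexed_lattice (J : finType) r (S : set (J -> 'rV[int]_r)) :
  subgroup S -> (forall y, exists2 m, (0 < m)%N & S (y *+ m)) ->
  exists n, indexed S n.
Proof.
move=> gS tors.
have evMn (F : J -> 'rV[int]_r) n j k : (F *+ n) j 0 k = F j 0 k *+ n.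
  elim: n => [|n IHn]; first by rewrite !mulr0n mxE.
  by rewrite !mulrS -IHn mxE.
have evMz (F : J -> 'rV[int]_r) z j k : (F *~ z) j 0 k = F j 0 k * z.
  case: z => n; first by rewrite -pmulrn evMn -mulr_natr natz.
  by rewrite NegzE mulrNz -pmulrn mxE evMn -mulr_natr natz mulrN.
pose d (p : J * 'I_r) : J -> 'rV[int]_r := fun j => if j == p.1 then delta_mx 0 p.2 else 0.
have /boolp.choice [m mP] : forall p, exists m, (0 < m)%N /\ S (d p *+ m).
  by move=> p; have [m m0 Sm] := tors (d p); exists m.
pose M := (\prod_p m p)%N.
have M0 : (0 < M)%N by rewrite prodn_gt0 // => p; case: (mP p).
have Sd p : S (d p *+ M).
  by rewrite /M (bigD1 p) //= mulrnA; apply: (subgroupMn gS); case: (mP p).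
have SM (y : J -> 'rV[int]_r) : S (y *+ M).
  have -> : y *+ M = \sum_p (d p *+ M) *~ y p.1 0 p.2.
    apply/funext => j; apply/rowP => k; rewrite evMn fct_sumE summxE.
    rewrite (bigD1 (j, k)) //= big1 => [|[j' k'] neq].
      by rewrite addr0 evMz evMn /d eqxx mxE !eqxx mulr_natl.
    rewrite evMz evMn /d /=; case: eqP => [eqj|_]; last by rewrite mxE mul0rn mul0r.
    rewrite mxE eqxx /=; case: eqP => [eqk|_]; last by rewrite mul0rn mul0r.
    by rewrite eqj eqk eqxx in neq.
  apply: (subgroup_sum gS) => p _; case: (y p.1 0 p.2) => n.
    by rewrite -pmulrn; apply: (subgroupMn gS).
  by rewrite NegzE mulrNz -pmulrn; apply/(subgroupN gS)/(subgroupMn gS).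
pose t (q : {ffun J * 'I_r -> 'I_M}) : J -> 'rV[int]_r :=
  fun j => \row_k (q (j, k) : nat)%:Z.
apply: (@indexed_cover _ _ gS _ t) => y.
have modM z : (`|(z %% M)%Z| < M)%N by lia.
exists [ffun p => Ordinal (modM (y p.1 ord0 p.2))].
rewrite (_ : y - _ = (fun j => \row_k (y j ord0 k %/ M)%Z) *+ M) //.
apply/funext => j; apply/rowP => k.
rewrite evMn !mxE ffunE /= -mulr_natr natz gez0_abs; last by apply: modz_ge0; lia.
by rewrite {1}(divz_eq (y j ord0 k) M) addrK.
Qed.

(* Zorn's lemma for the graphs of partial Q-linear maps extending the identity of
   Q. Applying rho to the entries of a real solution of an integral linear system
   gives a rational solution. *)
Lemma rational_retraction (R : realType) :
  exists rho : R -> rat, {morph rho : x y / x + y} /\ rho 1 = 1.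
Proof.
pose G1 : set (R * rat) := [set (ratr a, a) | a in setT].
pose P0 (G : set (R * rat)) := [/\ G1 `<=` G,
  forall x y, G x -> G y -> G (x.1 + y.1, x.2 + y.2),
  forall x (a : rat), G x -> G (ratr a * x.1, a * x.2) & forall q, G (0, q) -> q = 0].
have [F FP Ftot|G [GP Gmax]] := Zorn_bigcup (P := [set G | G = set0 \/ P0 G]).
  have P0F X x : F X -> X x -> P0 X.
    by move=> FX Xx; have [X0|//] := FP X FX; rewrite X0 in Xx.
  have [[x [X FX Xx]]|noF] := pselect (exists x, (\bigcup_(X in F) X) x); last first.
    by left; apply/seteqP; split=> // x Fx; case: noF; exists x.
  right; split=> [y G1y|y z [Y FY Yy] [Z FZ Zz]|y a [Y FY Yy]|q [Y FY Yq]].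
  - by have [GX _ _ _] := P0F X x FX Xx; exists X => //; apply: GX.
  - have [YZ|ZY] := Ftot Y Z FY FZ.
      by have [_ GD _ _] := P0F Z z FZ Zz; exists Z => //; apply: GD => //; apply: YZ.
    by have [_ GD _ _] := P0F Y y FY Yy; exists Y => //; apply: GD => //; apply: ZY.
  - by have [_ _ GZ _] := P0F Y y FY Yy; exists Y => //; apply: GZ.
  - by have [_ _ _ G0] := P0F Y _ FY Yq; apply: G0.
have {GP} [G1G GD GZ G0] : P0 G.
  case: GP => // GP; case: (Gmax G1).
    rewrite GP; split=> // /(_ (ratr 0, 0)) G10; apply: G10; by exists 0.
  right; split=> // [_ _ [a _ <-] [b _ <-]|_ a [b _ <-]|q [a _ [/eqP + <-]]].
  - by exists (a + b); rewrite // rmorphD.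
  - by exists (a * b); rewrite // rmorphM.
  - by rewrite fmorph_eq0 => /eqP.
have Gfun x q q' : G (x, q) -> G (x, q') -> q = q'.
  move=> Gq /(GZ _ (-1)) /(GD _ _ Gq) /=.
  by rewrite rmorphN1 !mulN1r subrr => /G0 /eqP; rewrite subr_eq0 => /eqP.
have /boolp.choice [rho rhoP] : forall x, exists q, G (x, q).
  move=> x; apply: contrapT => nGx.
  (* [G'] extends [G] by the value 0 at [x]. It is still single-valued because [x] is outside the
     domain of [G], which contradicts maximality. *)
  pose G' : set (R * rat) := [set y | exists a, G (y.1 - ratr a * x, y.2)].
  have GG' : G `<=` G' by move=> [y q] Gy; exists 0; rewrite rmorph0 mul0r subr0.
  case: (Gmax G').
    split=> // G'G; case: nGx; exists 0; apply: G'G; exists 1.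
    by rewrite rmorph1 mul1r subrr; apply: G1G; exists 0; rewrite // rmorph0.
  right; split=> [y /G1G /GG' //|y z [a Gy] [b Gz]|y a [b Gy]|q [a]].
  - exists (a + b); have /= := GD _ _ Gy Gz; congr (G (_, _)).
    by rewrite rmorphD /=; ring.
  - exists (a * b); have /= := GZ _ a Gy; congr (G (_, _)).
    by rewrite rmorphM /=; ring.
  - rewrite /= sub0r; have [->|a0 Gx] := eqVneq a 0.
      by rewrite rmorph0 mul0r oppr0; apply: G0.
    case: nGx; exists (- a^-1 * q); have /= := GZ _ (- a^-1) Gx; congr (G (_, _)).
    by rewrite rmorphN fmorphV /= mulrNN mulKf // fmorph_eq0.
exists rho; split=> [x y|]; first exact/(Gfun (x + y))/(GD (_, _) (_, _)).
by apply: (Gfun 1) => //; apply: G1G; exists 1; rewrite // rmorph1.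
Qed.

Lemma common_denominator (K : finType) (q : K -> rat) :
  exists2 m, (0 < m)%N & exists z : K -> int, forall k, q k * m%:R = (z k)%:~R.
Proof.
exists (\prod_k `|denq (q k)|)%N; first by rewrite prodn_gt0 // => k; rewrite absz_gt0 denq_neq0.
exists (fun k => numq (q k) * (\prod_(j | j != k) `|denq (q j)|)%N%:Z) => k.
by rewrite (bigD1 k) //= natrM mulrA rmorphM /= numqE -absz_denq.
Qed.

(** * Trees *)

Lemma linear_inj_dim (K : fieldType) (U W : vectType K) (f : U -> W) :
  linear f -> injective f -> (dim U <= dim W)%N.
Proof.
move=> lin_f inj_f; pose L : {linear U -> W} := HB.pack f (GRing.isLinear.Build _ _ _ _ f lin_f).
have /lker0P kerL : injective (linfun L) by move=> x y; rewrite !lfunE; apply: inj_f.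
rewrite -!dimvf -(limg_ker_dim (linfun L) fullv) capfv (eqP kerL) dimv0.
exact/dimvS/subvf.
Qed.

Lemma linear_surj_inj (K : fieldType) (U W : vectType K) (f : U -> W) :
  linear f -> (forall y, exists x, f x = y) -> dim U = dim W -> injective f.
Proof.
move=> lin_f surj_f eq_dim.
pose L : {linear U -> W} := HB.pack f (GRing.isLinear.Build _ _ _ _ f lin_f).
suff /lker0P inj_L : lker (linfun L) == 0%VS.
  by move=> x y eq_f; apply: inj_L; rewrite !lfunE.
have imgL : limg (linfun L) = fullv.
  apply/vspaceP => y; rewrite memvf; have [x <-] := surj_f y.
  by rewrite -[f x](lfunE L) memv_img ?memvf.
rewrite -dimv_eq0; have := limg_ker_dim (linfun L) fullv.
by rewrite capfv imgL !dimvf eq_dim; lia.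
Qed.

Lemma connect_ind (V : finType) (e : rel V) (P : V -> Prop) x :
  P x -> (forall y z, P y -> e y z -> P z) -> forall y, connect e x y -> P y.
Proof.
move=> Px Pe y /connectP [p + ->]; elim: p x Px => //= z p IHp x Px /andP[exz].
exact/IHp/(Pe x).
Qed.

Lemma neq_negb (b b' : bool) : b' != b -> b' = ~~ b.
Proof. by case: b b' => [] []. Qed.

Section Tree.
Variables (r : nat) (I : finType) (T : trop_type r I).
Implicit Types (F : {set tedge T}) (e : tedge T) (b : bool) (v : tvert T).

Lemma adjP F v w :
  reflect (exists e b, [/\ e \in F, tend e b = v & tend e (~~ b) = w]) (adj F v w).
Proof.
apply: (iffP exists_inP) => [[e eF /existsP[b /andP[/eqP <- /eqP <-]]]|[e [b [eF <- <-]]]].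
  by exists e, b.
by exists e => //; apply/existsP; exists b; rewrite !eqxx.
Qed.

Lemma adj_edge F e b : e \in F -> adj F (tend e b) (tend e (~~ b)).
Proof. by move=> eF; apply/adjP; exists e, b. Qed.

Lemma adj_connect_sym F : connect_sym (adj F).
Proof.
move=> v w; have /= <- := connect_rev (adj F) v w.
apply: eq_connect => x y /=; apply/adjP/adjP => -[e [b [eF <- <-]]];
by exists e, (~~ b); rewrite negbK.
Qed.

(* A function on the vertices is determined by its coboundary along F and its value at
   one vertex. *)
Lemma connected_card F :
  (forall v w, connect (adj F) v w) -> (#|tvert T| <= #|F| + 1)%N.
Proof.
move=> conn; case: (pickP (mem (tvert T))) => [v0 _|V0]; last by rewrite (eq_card0 V0).
pose f (H : {ffun tvert T -> rat^o}) : {ffun {e | e \in F} -> rat^o} * rat^o :=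
  ([ffun e => H (tend (val e) true) - H (tend (val e) false)], H v0).
have lin_f : linear f.
  move=> a H H'; rewrite /f; congr pair; last by rewrite !ffunE.
  by apply/ffunP => e; rewrite !ffunE scalerBr addrACA opprD.
suff inj_f : injective f.
  by have := linear_inj_dim lin_f inj_f; rewrite /dim /= /dim /= !muln1 card_sig.
have zero_f H : f H = 0 -> H = 0.
  case=> /ffunP Hd H0; apply/ffunP => v; rewrite !ffunE.
  apply: (connect_ind (P := fun v => H v = 0) H0) (conn v0 v) => x y Hx.
  case/adjP => e [b [eF ex ey]]; have := Hd (Sub e eF); rewrite !ffunE /= => /eqP.
  rewrite subr_eq0 => /eqP eqH; rewrite -ey.
  by case: b ex {ey} => ex; rewrite -?eqH ?ex // eqH ex.
move=> H H' eqf; apply/eqP; rewrite -subr_eq0; apply/eqP/zero_f.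
by have := lin_f (-1) H' H; rewrite eqf !scaleN1r addNr addrC.
Qed.

Hypothesis conn : forall v w, connect (adj [set: tedge T]%SET) v w.
Hypothesis acyclic : #|tvert T| = (#|tedge T| + 1)%N.

Lemma side_edge e b e' b' :
  e' != e -> tend e' b' \in side e b -> tend e' (~~ b') \in side e b.
Proof.
move=> ne; rewrite !inE => /connect_trans; apply.
by apply/connect1/adj_edge; rewrite !inE.
Qed.

(** Otherwise the graph without [e] would still be connected, with one edge too few for
    [connected_card]. *)
Lemma side_bridge e b : tend e (~~ b) \notin side e b.
Proof.
rewrite inE; apply/negP => cyc.
have cyc' b' : connect (adj (~: [set e])%SET) (tend e b') (tend e (~~ b')).
  by case: b cyc b' => cyc [] //=; rewrite adj_connect_sym.
have conn' v w : connect (adj (~: [set e])%SET) v w.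
  apply: connect_sub (conn v w) => x y /adjP[e' [b' [_ <- <-]]].
  have [->|ne] := eqVneq e' e; first exact: cyc'.
  by apply/connect1/adj_edge; rewrite !inE.
have := connected_card conn'; have := cardsC [set e]%SET; rewrite cards1 acyclic.
lia.
Qed.

Lemma side_disjoint e b v : v \in side e b -> v \notin side e (~~ b).
Proof.
rewrite !inE => eb; apply/negP => ev; have := side_bridge e b.
by rewrite inE (connect_trans eb) // adj_connect_sym.
Qed.

Lemma side_cover e v : exists b, v \in side e b.
Proof.
apply: (connect_ind (P := fun v => exists b, v \in side e b) _ _ (conn (tend e true) v)).
  by exists true; apply: tend_side.
move=> x y [b xb] /adjP[e' [b' [_ ex <-]]].
have [->|ne] := eqVneq e' e; first by exists (~~ b'); apply: tend_side.
by exists b; rewrite side_edge // ex.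
Qed.

Lemma side_end e b e' b' : tend e' b' \in side e b -> tend e' (~~ b') \notin side e b ->
  e' = e /\ b' = b.
Proof.
have [->|ne e'b] := eqVneq e' e; last by rewrite side_edge.
move=> eb' _; split=> //; apply/eqP; apply: contraTT eb' => /neq_negb ->.
exact: side_bridge.
Qed.

Lemma flag_neq_edge e b e' b' : tend e' b' = tend e b -> (e', b') != (e, b) -> e' != e.
Proof.
move=> eqv; apply: contraNneq => ee'; move: eqv; rewrite ee'.
case: (eqVneq b' b) => [->|/neq_negb ->].
  by rewrite eqxx.
by move=> eqv; have := side_bridge e b; rewrite eqv tend_side.
Qed.

(** A path in the far side of [e'] could leave [side e b] only through [e], hence from [tend e b];
    but this vertex is the near end of [e']. *)
Lemma side_sub e b e' b' : tend e' b' = tend e b -> (e', b') != (e, b) ->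
  side e' (~~ b') \subset side e b.
Proof.
move=> eqv nf; have ne := flag_neq_edge eqv nf.
apply/fintype.subsetP => v; rewrite [v \in side e' _]inE.
pose P v := (v \in side e b) && (v \in side e' (~~ b')).
move=> cv; suff /andP[] : P v by [].
apply: (connect_ind (P := P) _ _ cv) => [|x y /andP[xe xe'] /adjP[e2 [b2 [e2F ex ey]]]].
  by rewrite /P tend_side side_edge // eqv tend_side.
have ye' : y \in side e' (~~ b') by rewrite -ey side_edge ?ex //; rewrite !inE in e2F.
rewrite /P ye' andbT; apply: contraTT xe' => ye.
rewrite -ex in xe *; rewrite -ey in ye; have [-> ->] := side_end xe ye.
by rewrite -eqv -{1}[b']negbK side_bridge.
Qed.

(** The decrease that drives the induction from the leaves: the root [tend e b] belongs only to the
    larger side. *)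
Lemma side_card e b e' b' : tend e' b' = tend e b -> (e', b') != (e, b) ->
  (#|side e' (~~ b')| < #|side e b|)%N.
Proof.
move=> eqv nf; apply: proper_card; apply/properP; split; first exact: side_sub.
by exists (tend e b); rewrite ?tend_side // -eqv -{1}[b']negbK side_bridge.
Qed.

(** A path from [v] stays in the branch it has entered until it crosses the edge of that branch
    again, which brings it back to [v]. *)
Lemma branch_cover v w : v != w -> exists e b, tend e b = v /\ w \in side e (~~ b).
Proof.
move=> nvw; pose P w := v = w \/ exists e b, tend e b = v /\ w \in side e (~~ b).
suff [eqv|//] : P w by rewrite eqv eqxx in nvw.
apply: (connect_ind (P := P) _ _ (conn v w)) => [|x y Px /adjP[e2 [b2 [_ ex ey]]]].
  by left.
case: Px => [vx|[e [b [ev xe]]]].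
  by right; exists e2, b2; rewrite -ey tend_side vx.
have [ye|ye] := boolP (y \in side e (~~ b)); first by right; exists e, b.
rewrite -ex in xe; rewrite -ey in ye; have [ee bb] := side_end xe ye.
by left; rewrite -ey ee bb negbK.
Qed.

End Tree.

(** * Linear spans and the lattices W_E *)

Section LinSpan.
Variables (R : realType) (W : lmodType R) (S : set W).

Lemma lin_span0 : lin_span S 0.
Proof. by exists 0%N, (fun=> 0), (fun=> 0), (fun=> 0); split=> [[]|]; rewrite ?big_ord0. Qed.

Lemma lin_span_diff a u v : S u -> S v -> lin_span S (a *: (u - v)).
Proof.
by move=> Su Sv; exists 1%N, (fun=> a), (fun=> u), (fun=> v); rewrite big_ord1.
Qed.

Lemma lin_spanD x y : lin_span S x -> lin_span S y -> lin_span S (x + y).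
Proof.
move=> [k [a [u [v [Suv ->]]]]] [k' [a' [u' [v' [Suv' ->]]]]].
pose cat X (F : 'I_k -> X) (F' : 'I_k' -> X) (i : 'I_(k + k')) :=
  match fintype.split i with inl j => F j | inr j => F' j end.
exists (k + k')%N, (cat _ a a'), (cat _ u u'), (cat _ v v'); split=> [i|].
  by rewrite /cat; case: fintype.split.
rewrite big_split_ord /=; congr (_ + _); apply: eq_bigr => i _; rewrite /cat.
  by case: split_ordP => j /eqP; rewrite ?eq_lshift ?eq_lrshift // => /eqP ->.
by case: split_ordP => j /eqP; rewrite ?eq_rshift ?eq_rlshift // => /eqP ->.
Qed.

Lemma lin_spanZ b x : lin_span S x -> lin_span S (b *: x).
Proof.
move=> [k [a [u [v [Suv ->]]]]]; exists k, (fun i => b * a i), u, v; split=> //.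
by rewrite scaler_sumr; apply: eq_bigr => i _; rewrite scalerA.
Qed.

Lemma lin_span_min (P : W -> Prop) :
  P 0 -> (forall a x y, P x -> P y -> P (a *: x + y)) ->
  (forall u v, S u -> S v -> P (u - v)) -> forall x, lin_span S x -> P x.
Proof.
move=> P0 PL Pdiff x [k [a [u [v [Suv ->]]]]].
by elim/big_rec: _ => // i y _ Py; apply: PL => //; apply: Pdiff; case: (Suv i).
Qed.

End LinSpan.

Lemma toRB (R : realType) m n : {morph @toR R m n : x y / x - y}.
Proof. exact: map_mxB. Qed.

Lemma toR_Mn (R : realType) m n (x : 'M[int]_(m, n)) k : toR R (x *+ k) = toR R x *+ k.
Proof. by rewrite /toR raddfMn. Qed.

Lemma subgroup_lat_span (R : realType) r (S : set 'rV[R]_r) : subgroup (lat_span S).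
Proof.
split=> [|x y Sx Sy]; rewrite /lat_span /=.
  by rewrite /toR raddf0; apply: lin_span0.
by rewrite toRB -scaleN1r; apply/lin_spanD/lin_spanZ.
Qed.

Lemma lin_span_aset (R : realType) r (A : rat_affine R r) x :
  lin_span (aset A) x <-> (x <= toR R (adir A))%MS.
Proof.
split=> [|/submxP [y ->]].
  apply: (lin_span_min (P := fun x => (x <= toR R (adir A))%MS)) => [|a u v uA vA|].
  - exact: sub0mx.
  - by rewrite addmx_sub ?scalemx_sub.
  move=> _ _ [y _ <-] [z _ <-].
  by rewrite opprD addrACA subrr add0r -mulmxBl submxMl.
rewrite -[_ *m _](addKr (apt A)) addrC -[_ - _]scale1r.
apply: lin_span_diff; first by exists y.
by exists 0; rewrite ?mul0mx ?addr0.
Qed.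

(** One step size for finitely many open conditions, so that a tangent vector can be realized by an
    actual small deformation. *)
Lemma small_multiple (R : realType) (K : finType) (a bound : K -> R) :
  (forall k, 0 < bound k) ->
  exists2 d, 0 < d & forall k, `|d * a k| < bound k.
Proof.
move=> b0; suff [d d0 dP] : exists2 d, 0 < d & forall k, k \in enum K -> `|d * a k| < bound k.
  by exists d => // k; apply: dP; rewrite mem_enum.
elim: (enum K) => [|k s [d d0 dP]]; first by exists 1.
pose d' := bound k / (`|a k| + 1); have a1 : 0 < `|a k| + 1 by rewrite ltr_wpDl.
have d'0 : 0 < d' by rewrite divr_gt0.
exists (Num.min d d'); first by rewrite lt_min d0.
have m0 : 0 < Num.min d d' by rewrite lt_min d0.
move=> j; rewrite inE normrM gtr0_norm // => /orP[/eqP ->|/dP].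
  apply: le_lt_trans (_ : d' * `|a k| < _); first by rewrite ler_wpM2r // ge_min lexx orbT.
  by rewrite /d' -mulrA gtr_pMr // mulrC ltr_pdivrMr // mul1r ltrDl.
rewrite normrM gtr0_norm //; apply: le_lt_trans.
by rewrite ler_wpM2r // ge_min lexx.
Qed.

(** * Infinitesimal deformations of one side of an edge *)

Section Branches.
Variables (R : realType) (r : nat) (I : finType) (T : trop_type r I).
Variables (A : I -> rat_affine R r).
Implicit Types (e : tedge T) (b : bool) (v : tvert T) (H : tvert T -> 'rV[R]_r).

(* Tangent vectors, along the vertices in D, to the curves of type T matching A. *)
Definition flex (D : {set tvert T}) H : Prop :=
  (forall e, tend e false \in D -> tend e true \in D ->
     exists l : R, H (tend e true) - H (tend e false) = l *: toR R (uedge e)) /\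
  (forall i, tleg T i \in D -> (H (tleg T i) <= toR R (adir (A i)))%MS).

(** The linear space swept out by the translates of the cut edge: displacements of its end, together
    with the direction of the edge itself. *)
Definition branch e b (x : 'rV[R]_r) : Prop :=
  exists2 H, flex (side e b) H & exists t : R, x = H (tend e b) + t *: toR R (uedge e).

Lemma flexL D a H H' : flex D H -> flex D H' -> flex D (fun v => a *: H v + H' v).
Proof.
move=> [He Hi] [He' Hi']; split=> [e e0 e1|i iD]; last first.
  by rewrite addmx_sub ?scalemx_sub ?Hi ?Hi'.
have [l El] := He e e0 e1; have [l' El'] := He' e e0 e1.
by exists (a * l + l'); rewrite opprD addrACA -scalerBr El El' scalerA scalerDl.
Qed.

Lemma flex0 D : flex D (fun=> 0).
Proof.
by split=> [e _ _|i _]; [exists 0; rewrite subrr scale0r | apply: sub0mx].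
Qed.

Lemma branchL e b a x y : branch e b x -> branch e b y -> branch e b (a *: x + y).
Proof.
move=> [H fH [t ->]] [H' fH' [t' ->]]; exists (fun v => a *: H v + H' v); first exact: flexL.
by exists (a * t + t'); rewrite scalerDr addrACA scalerA scalerDl.
Qed.

Lemma branch0 e b : branch e b 0.
Proof. by exists (fun=> 0); [apply: flex0 | exists 0; rewrite scale0r addr0]. Qed.

Lemma branch_edge e b t : branch e b (t *: toR R (uedge e)).
Proof. by exists (fun=> 0); [apply: flex0 | exists t; rewrite add0r]. Qed.

Lemma branchB e b x y : branch e b x -> branch e b y -> branch e b (x - y).
Proof. by move=> Bx By; rewrite addrC -scaleN1r; apply: branchL. Qed.

End Branches.

Section Sweep.
Variables (R : realType) (r : nat) (I : finType) (T : trop_type r I).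
Variables (A : I -> rat_affine R r) (s : I -> nat) (c : config R T).
Implicit Types (e : tedge T) (b : bool).
Hypothesis conn : forall v w, connect (adj [set: tedge T]%SET) v w.
Hypothesis acyclic : #|tvert T| = (#|tedge T| + 1)%N.
Hypothesis curve_c : curves_of_type c.
Hypothesis match_c : matches A c.
Hypothesis psi_c : satisfies_psi T s.

Lemma side_inner e b e' :
  tend e' false \in side e b -> tend e' true \in side e b -> e' != e.
Proof.
move=> e0; apply: contraTneq => ee; move: e0; rewrite ee => e0.
case: b e0 => e0; last exact: (side_bridge conn acyclic e false).
by have := side_bridge conn acyclic e true; rewrite e0.
Qed.

(** No vertex loses a flag by the cut, since the half of [e] survives as the new leg, and that leg
    carries the value 0. So [ov] does not drop and the sums do not grow. *)
Lemma satisfies_psi_cut e b : satisfies_psi (cut_type e b) (cut_psi s).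
Proof.
move=> v; have /= psi_v := psi_c (val v).
have le_sum : (\sum_(o | (tleg (cut_type e b) o == v) && (lwt (cut_type e b) o == 0%N))
    cut_psi s o <= \sum_(i | (tleg T i == val v) && (lwt T i == 0%N)) s i)%N.
  rewrite (bigID isSome) /= [X in (_ + X)%N]big1 ?addn0 => [|[i|] /andP[]//].
  rewrite (reindex_omap (insub : I -> option (cut_mark e b)) (omap val)) /=; last first.
    by case=> [m|] /andP[] //= _ _; rewrite valK.
  rewrite big_mkcond [leqRHS]big_mkcond; apply: leq_sum => i _.
  case: insubP => [m _ mi|_] /=; last by rewrite andbF.
  by rewrite -mi eqxx !andbT -val_eqE.
have le_val : (valence (val v : tvert T) <= valence v)%N.
  pose g (f : flag (cut_type e b)) : flag T := match f with
    | inl (e', b') => inl (val e', b')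
    | inr (Some i) => inr (val i)
    | inr None => inl (e, b) end.
  apply: leq_trans (leq_image_card g _); apply/subset_leq_card/fintype.subsetP => f.
  rewrite inE => /eqP fv; apply/fintype.imageP.
  have vb := valP v; rewrite -fv in vb.
  case: f => [[e' b']|i] /= in fv vb *; last first.
    by exists (inr (Some (exist _ i vb))); rewrite // inE; apply/eqP/val_inj.
  have [ee|ne] := eqVneq e' e.
    have bb : b' = b.
      apply/eqP; apply: contraTT vb => /neq_negb ->; rewrite ee.
      exact: side_bridge.
    by exists (inr None); rewrite ?ee ?bb // inE; apply/eqP/val_inj; rewrite /= -fv ee bb.
  have e'P : (e' != e) && [forall b0, tend e' b0 \in side e b].
    rewrite ne; apply/forallP => b0; have [->//|/neq_negb ->] := eqVneq b0 b'.
    exact: side_edge.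
  by exists (inl (exist _ e' e'P, b')); rewrite // inE; apply/eqP/val_inj.
apply: le_trans (le_trans psi_v _); first by rewrite lez_nat.
by rewrite /ov /= lerD2r lerD2r lez_nat.
Qed.

Lemma leg_dir i : (toR R (uleg T i) <= toR R (adir (A i)))%MS.
Proof.
have [y _ y0] : aset (A i) (c.1 (tleg T i)).
  by apply: match_c; exists 0; rewrite ?scale0r ?addr0.
have [z _ z1] : aset (A i) (c.1 (tleg T i) + toR R (uleg T i)).
  by apply: match_c; exists 1; rewrite ?scale1r ?ler01.
have -> : toR R (uleg T i) = (z - y) *m toR R (adir (A i)).
  by rewrite mulmxBl -[LHS](addKr (c.1 (tleg T i))) -z1 -{1}y0 opprD addrACA addNr add0r addrC.
exact: submxMl.
Qed.

Lemma aset_diff (B : rat_affine R r) x y :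
  aset B x -> aset B y -> (x - y <= toR R (adir B))%MS.
Proof. by move=> Bx By; apply/lin_span_aset; rewrite -[x - y]scale1r; apply: lin_span_diff. Qed.

Lemma leg_image0 (J : finType) (T' : trop_type r J) (c' : config R T') j :
  leg_image c' j (c'.1 (tleg T' j)).
Proof. by exists 0; rewrite ?scale0r ?addr0. Qed.

Lemma toR_fdir e b : toR R (fdir (inl (e, b) : flag T)) = (-1) ^+ b *: toR R (uedge e).
Proof. by case: b; rewrite /= ?expr1 ?expr0 ?scale1r // /toR raddfN scaleN1r. Qed.

(** The edge and constraint conditions are affine, so the difference of two deformed curves solves
    their linear parts; the positions along the leg add multiples of u_E. *)
Lemma sweep_branch e b eps x y :
  sweep A s c e b eps x -> sweep A s c e b eps y -> branch A e b (x - y).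
Proof.
pose ext (c' : config R (cut_type e b)) (v : tvert T) : 'rV[R]_r :=
  oapp (fun v' : cut_vert e b => c'.1 v') 0 (insub v).
have extE c' (v : cut_vert e b) : ext c' (val v) = c'.1 v by rewrite /ext valK.
move=> [c1 [cur1 _ mat1 _ [t1 _ ->]]] [c2 [cur2 _ mat2 _ [t2 _ ->]]].
exists (fun v => ext c1 v - ext c2 v); first split=> [e' e0 e1|i ib].
- have e'P : (e' != e) && [forall b0, tend e' b0 \in side e b].
    rewrite (side_inner e0 e1); by apply/forallP => -[].
  have [_] := cur1 (exist _ e' e'P); have [_] := cur2 (exist _ e' e'P).
  set l1 := c1.2 _; set l2 := c2.2 _ => E2 E1; exists (l1 - l2).
  have endE c' (b' : bool) (vb : tend e' b' \in side e b) :
      ext c' (tend e' b') = c'.1 (tend (exist _ e' e'P : tedge (cut_type e b)) b').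
    by rewrite -extE.
  by rewrite !endE // E1 E2 /=; apply/rowP => j; rewrite !mxE; ring.
- pose j : option (cut_mark e b) := Some (exist _ i ib).
  rewrite -[tleg T i]/(val (tleg (cut_type e b) j)) !extE.
  by apply: aset_diff; [apply: (mat1 j)|apply: (mat2 j)]; apply: leg_image0.
- exists (t1 * (-1) ^+ b - t2 * (-1) ^+ b).
  rewrite -[tend e b]/(val (tleg (cut_type e b) None)) !extE.
  by rewrite [toR _ _]toR_fdir !scalerA scalerBl opprD addrACA.
Qed.

(** A tangent vector, scaled down and added to [c], is an admissible deformation however small [eps]
    is; hence the span does not depend on [eps]. *)
Lemma sweep_span e b eps x : 0 < eps ->
  lin_span (sweep A s c e b eps) x <-> branch A e b x.
Proof.
move=> eps0; split.
  apply: lin_span_min; first exact: branch0.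
    by move=> a y z; apply: branchL.
  exact: sweep_branch.
move=> [H [fe fi] [t ->]].
have /boolp.choice [l lP] : forall e', exists l : R, tend e' false \in side e b ->
    tend e' true \in side e b -> H (tend e' true) - H (tend e' false) = l *: toR R (uedge e').
  move=> e'; have [[e0 e1]|no] := pselect (tend e' false \in side e b /\ tend e' true \in side e b).
    by have [l El] := fe e' e0 e1; exists l.
  by exists 0 => e0 e1; case: no.
pose a (k : tedge T + tvert T * 'I_r) := match k with inl e' => l e' | inr (v, j) => H v 0 j end.
(* Keeping the variation of a length below [c.2 e'] leaves the new length positive; [eps] gives
   closeness. *)
pose bound (k : tedge T + tvert T * 'I_r) : R := match k with
  | inl e' => Num.min eps (c.2 e' : R) | inr _ => eps end.
have bound0 k : 0 < bound k.
  by case: k => [e'|//]; rewrite /= lt_min eps0; have [] := curve_c e'.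
have [d d0 dP] := small_multiple a bound0.
pose c' : config R (cut_type e b) :=
  ([ffun v : cut_vert e b => c.1 (val v) + d *: H (val v)],
   [ffun e' : cut_edge e b => (c.2 (val e') : R) + d * l (val e')]).
have in_sweep (c0 : config R (cut_type e b)) y : curves_of_type c0 ->
    close eps (cut_config e b c) c0 -> matches (cut_constraint A) c0 ->
    leg_image c0 None y -> sweep A s c e b eps y.
  by move=> *; exists c0; split=> //; apply: satisfies_psi_cut.
have [cut0 cut1] : curves_of_type (cut_config e b c) /\ curves_of_type c'.
  split=> -[e' e'P]; have := e'P => /andP[_ /forallP e'b]; rewrite !ffunE /=.
    exact: curve_c.
  have [c0 ->] := curve_c e'; split.
    have := dP (inl e'); rewrite /= lt_min => /andP[_]; rewrite ltr_norml => /andP[].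
    by rewrite -subr_gt0 opprK addrC.
  have /eqP := lP e' (e'b false) (e'b true); rewrite subr_eq => /eqP ->.
  by apply/rowP => j; rewrite !mxE; ring.
have mat_cut (c0 : config R (cut_type e b)) :
    (forall i (ib : tleg T i \in side e b),
      (c0.1 (tleg (cut_type e b) (Some (exist _ i ib : cut_mark e b))) - c.1 (tleg T i)
        <= toR R (adir (A i)))%MS) ->
    matches (cut_constraint A) c0.
  move=> c0P [[i ib]|] _ [t' t'0 ->]; last first.
    exists (c0.1 (tleg (cut_type e b) None) + t' *: toR R (uleg (cut_type e b) None)) => //.
    by rewrite /= /toR map_mx1 mulmx1 add0r.
  have [y _ yE] : aset (A i) (c.1 (tleg T i)) by apply/match_c/leg_image0.
  have /submxP [z zE] := c0P i ib; have /submxP [w wE] := leg_dir i.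
  exists (y + z + t' *: w) => //; rewrite !mulmxDl -scalemxAl -zE -wE -yE /=.
  by set Y := y *m _; apply/rowP => j; rewrite !mxE; ring.
pose x1 := c'.1 (tleg (cut_type e b) None).
pose x0 := (cut_config e b c).1 (tleg (cut_type e b) None).
have Sx1 : sweep A s c e b eps x1.
  apply: (in_sweep c') (leg_image0 _ _) => //; first split=> [v j|e'].
  - by rewrite !ffunE !mxE addrAC subrr add0r; apply: (dP (inr (val v, j))).
  - rewrite !ffunE addrAC subrr add0r.
    by have := dP (inl (val e')); rewrite /= lt_min => /andP[].
  - apply: mat_cut => i ib; rewrite ffunE addrAC subrr add0r /=.
    by rewrite scalemx_sub ?fi.
have cut_close : close eps (cut_config e b c) (cut_config e b c).
  by split=> *; rewrite subrr normr0.
have cut_match : matches (cut_constraint A) (cut_config e b c).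
  by apply: mat_cut => i ib; rewrite ffunE subrr sub0mx.
have Sx0 : sweep A s c e b eps x0 by apply: in_sweep (leg_image0 _ _).
have Sx2 : sweep A s c e b eps (x0 + toR R (fdir (inl (e, b) : flag T))).
  by apply: (in_sweep (cut_config e b c)) => //; exists 1; rewrite ?ler01 ?scale1r.
(* The displacement comes from the deformed and the original end, the multiple of u_E from two
   points of the original leg. *)
have -> : H (tend e b) + t *: toR R (uedge e) = d^-1 *: (x1 - x0) +
    ((-1) ^+ b * t) *: (x0 + toR R (fdir (inl (e, b) : flag T)) - x0).
  rewrite /x1 /x0 !ffunE ![c.1 _ + _]addrC !addrK scalerA mulVf ?gt_eqF // scale1r.
  by rewrite toR_fdir scalerA mulrAC -expr2 sqrr_sign mul1r.
by apply: lin_spanD; apply: lin_span_diff.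
Qed.

Lemma W_edgeP e b n : W_edge A s c e b n <-> branch A e b (toR R n).
Proof.
split=> [Wn|Bn eps /= eps0]; last by apply/sweep_span.
by apply/(sweep_span e b (toR R n) (@ltr01 R)); apply: Wn; apply: ltr01.
Qed.

Lemma subgroup_W_edge e b : subgroup (W_edge A s c e b).
Proof.
split=> [|x y /W_edgeP Bx /W_edgeP By]; apply/W_edgeP.
  by rewrite /toR raddf0; apply: branch0.
by rewrite toRB; apply: branchB.
Qed.

End Sweep.

(** * Rigid curves *)

(** In the basis [row_ebase M], the coordinates from the rank of [M] onwards are coordinates on the
    quotient by the row space. They serve as coordinates on N_R / L(A_i). *)
Lemma submx_coord (K : fieldType) n (M : 'M[K]_n) (x : 'rV[K]_n) :
  (x <= M)%MS <-> forall j : 'I_n, (\rank M <= j)%N -> (x *m invmx (row_ebase M)) 0 j = 0.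
Proof.
rewrite submxE /cokermx mulmxA; set w := x *m _.
have wE j : (w *m copid_mx (\rank M)) 0 j = if (j < \rank M)%N then 0 else w 0 j.
  move: w => w; rewrite /copid_mx mulmxBr mulmx1 !mxE (bigD1 j) //= big1 => [|k neq]; rewrite mxE.
    by rewrite eqxx /= addr0; case: ltnP; rewrite ?mulr1 ?subrr // mulr0 subr0.
  by rewrite -val_eqE /= in neq; rewrite (negbTE neq) mulr0.
split=> [/eqP w0 j rj|w0].
  by have := wE j; rewrite w0 mxE ltnNge rj.
by apply/eqP/rowP => j; rewrite wE [RHS]mxE; case: ltnP => // /w0.
Qed.

Section Rigid.
Variables (R : realType) (r : nat) (I : finType) (A : I -> rat_affine R r).
Variables (s : I -> nat) (T : trop_type r I) (c : config R T).
Implicit Types (e : tedge T) (b : bool) (v : tvert T).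
Hypotheses (hgenus : genus T = 0%N) (hrigid : rigid A s c).

Lemma rigid_conn v w : connect (adj [set: tedge T]%SET) v w.
Proof. by case: hrigid => -[[[_ conn _ _ _] _] _ _ _ _] _ _ _; apply: conn. Qed.

Lemma rigid_curve : curves_of_type c.
Proof. by case: hrigid => -[[_ ?] _ _ _ _]. Qed.

Lemma rigid_matches : matches A c.
Proof. by case: hrigid => -[]. Qed.

Lemma rigid_psi : satisfies_psi T s.
Proof. by case: hrigid => -[]. Qed.

(** Genus 0 makes the first Betti number vanish, which for a single component is the inequality
    opposite to [connected_card]. *)
Lemma rigid_acyclic : #|tvert T| = (#|tedge T| + 1)%N.
Proof.
have := connected_card rigid_conn; rewrite cardsT => le1.
apply/eqP; rewrite eqn_leq le1 /=.
have /andP[+ _] : (betti [set: tedge T]%SET == 0%N) && (\sum_v tgen (t := T) v == 0)%N.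
  by rewrite -addn_eq0; apply/eqP/hgenus.
rewrite /betti cardsT subn_eq0; apply: leq_trans; rewrite leq_add2l.
have [[[/card_gt0P [v0 _] _ _ _ _] _] _ _ _ _] : in_moduli (genus T) (degree T) A s c.
  by case: hrigid.
rewrite -(n_comp_connect (@adj_connect_sym _ _ T [set: tedge T]%SET) v0).
by rewrite (eq_n_comp_r (a' := tvert T)) // => v; rewrite !inE; apply: rigid_conn.
Qed.

(** The valences add up to 2 #E + #I and all vertex genera are 0; substituting #V = #E + 1 leaves r
    + #E. *)
Lemma rigid_dtrop : dtrop T = (r + #|tedge T|)%N%:Z.
Proof.
have gen0 (v : tvert T) : tgen v = 0%N by have [_ _ [_ + _] _] := hrigid; apply.
rewrite /dtrop hgenus /ov_total.
have -> : \sum_(v : tvert T) ov v = \sum_(v : tvert T) (valence v)%:Z - 3 * #|tvert T|%:Z.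
  have <- : \sum_(v : tvert T) (3 : int) = 3 * #|tvert T|%:Z.
    by rewrite sumr_const -[LHS]mulr_natr [X in _ * X]natz.
  rewrite -sumrB; apply: eq_bigr => v _.
  by rewrite /ov gen0 muln0 addr0.
have -> : \sum_(v : tvert T) (valence v)%:Z = (#|tedge T| * 2 + #|I|)%:Z.
  rewrite (eq_bigr (fun v : tvert T => \sum_(f : flag T | fvert f == v) (1 : int))) => [|v _].
    have <- : \sum_(f : flag T) (1 : int) = \sum_(v : tvert T) \sum_(f : flag T | fvert f == v) 1.
      by rewrite (partition_big (@fvert _ _ T) xpredT).
    rewrite sumr_const.
    by rewrite natz -[#|flag T|]/(#|{: (tedge T * bool) + I}|) card_sum card_prod card_bool.
  by rewrite sumr_const natz.
rewrite rigid_acyclic; lia.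
Qed.

(* Genericity of A solves this for y = 0; a general y is the coboundary of the sum
   of the y e, each placed on one side of e. *)
Lemma rigid_surj (y : tedge T -> 'rV[R]_r) (z : I -> 'rV[R]_r) :
  exists H : tvert T -> 'rV[R]_r,
    (forall e, exists l : R, H (tend e true) - H (tend e false) - y e = l *: toR R (uedge e)) /\
    (forall i, (H (tleg T i) - z i <= toR R (adir (A i)))%MS).
Proof.
have [_ gen _ _] := hrigid; have in_mod : in_moduli (genus T) (degree T) A s c by case: hrigid.
(* The [a] for which the system with zero edge data is solvable form a linear space. It contains all
   differences of matched translates, hence everything by genericity. *)
pose Q (a : {ffun I -> 'rV[R]_r}) := exists H : tvert T -> 'rV[R]_r,
  (forall e, exists l : R, H (tend e true) - H (tend e false) = l *: toR R (uedge e)) /\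
  (forall i, (H (tleg T i) - a i <= toR R (adir (A i)))%MS).
have QT a : Q a.
  have : lin_span (ev_translates T A) a by rewrite (gen T c in_mod).
  move: a; apply: lin_span_min => [|k a a' [H [He Hi]] [H' [He' Hi']]|a a'].
  - exists (fun=> 0); split=> [e|i]; first by exists 0; rewrite subrr scale0r.
    by rewrite ffunE subrr sub0mx.
  - exists (fun v => k *: H v + H' v); split=> [e|i].
      have [l El] := He e; have [l' El'] := He' e; exists (k * l + l').
      by rewrite opprD addrACA -scalerBr El El' scalerA scalerDl.
    by rewrite !ffunE opprD addrACA -scalerBr addmx_sub ?scalemx_sub.
  - move=> [c1 cur1 mat1] [c2 cur2 mat2]; exists (fun v => c1.1 v - c2.1 v); split=> [e|i].
      have [_ ->] := cur1 e; have [_ ->] := cur2 e; exists ((c1.2 e : R) - c2.2 e).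
      by apply/rowP => j; rewrite !mxE; ring.
    have [u _ uE] := mat1 i _ (leg_image0 c1 i); have [w _ wE] := mat2 i _ (leg_image0 c2 i).
    rewrite -uE -wE !ffunE /= (_ : _ - _ = (u - w) *m toR R (adir (A i))) ?submxMl //.
    rewrite mulmxBl; set U := u *m _; set W := w *m _.
    by apply/rowP => j; rewrite !mxE; ring.
pose H0 v := \sum_(e | v \in side e true) y e.
have [H [He Hi]] := QT [ffun i => z i - H0 (tleg T i)].
exists (fun v => H v + H0 v); split=> [e|i]; last first.
  by have := Hi i; rewrite ffunE opprB addrA.
have [l El] := He e; exists l; rewrite -El.
suff -> : H0 (tend e true) = y e + H0 (tend e false).
  by set h := H0 _; apply/rowP => j; rewrite !mxE; ring.
rewrite /H0 (bigD1 e) ?tend_side //=; congr (_ + _); apply: eq_bigl => e'.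
have [->|ne] := eqVneq e' e.
  by rewrite andbF (negbTE (side_bridge rigid_conn rigid_acyclic e true)).
rewrite andbT; apply/idP/idP => /side_edge; apply; rewrite eq_sym //.
Qed.

(* The surjection of [rigid_surj], written in coordinates of the N_R / L(A_i), goes
   between spaces of equal dimension since the codimensions add up to r + #|E|. *)
Lemma rigid_ker (H : tvert T -> 'rV[R]_r) :
  (forall e, exists l : R, H (tend e true) - H (tend e false) = l *: toR R (uedge e)) ->
  (forall i, (H (tleg T i) <= toR R (adir (A i)))%MS) -> forall v, H v = 0.
Proof.
pose S := {p : I * 'I_r | (\rank (toR R (adir (A p.1))) <= p.2)%N}.
pose Lam (x : {ffun tvert T -> 'rV[R]_r} * {ffun tedge T -> R^o}) :
    {ffun tedge T -> 'rV[R]_r} * {ffun S -> R^o} :=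
  ([ffun e => x.1 (tend e true) - x.1 (tend e false) - (x.2 e : R) *: toR R (uedge e)],
   [ffun p : S => (x.1 (tleg T (val p).1) *m
     invmx (row_ebase (toR R (adir (A (val p).1))))) 0 (val p).2]).
have linL : linear Lam.
  move=> a x x'; congr pair; apply/ffunP => k; rewrite !ffunE /=.
    rewrite -[a *: x.2 k]/(a * (x.2 k : R)).
    by apply/rowP => j; rewrite !mxE; ring.
  by rewrite mulmxDl -scalemxAl !mxE.
have surjL yq : exists x, Lam x = yq.
  case: yq => y q.
  pose w i : 'rV[R]_r := \row_j oapp (fun p : S => (q p : R)) 0 (insub (i, j)).
  pose z i := w i *m row_ebase (toR R (adir (A i))).
  have [h [he hi]] := rigid_surj y z; have /boolp.choice [l lP] := he.
  exists ([ffun v => h v], [ffun e => l e]); congr pair; apply/ffunP => k; rewrite !ffunE /=.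
    by rewrite -lP opprB addrC subrK.
  case: k => -[i j] /= ij; have /submx_coord /(_ j ij) /eqP := hi i.
  rewrite mulmxBl mxE [(- _ : 'M__) _ _]mxE subr_eq0 => /eqP ->.
  by rewrite /z mulmxK ?row_ebase_unit // mxE insubT.
have cardS : #|{: S}| = (r + #|tedge T|)%N.
  have [_ _ _] := hrigid; rewrite rigid_dtrop => /eqP; rewrite eqz_nat => /eqP <-.
  rewrite card_sig -sum1_card.
  rewrite (eq_bigl (fun p : I * 'I_r => true && (\rank (toR R (adir (A p.1))) <= p.2)%N)) //.
  rewrite -(pair_big_dep xpredT (fun i (j : 'I_r) => (\rank (toR R (adir (A i))) <= j)%N)
    (fun _ _ => 1%N)) /=.
  apply: eq_bigr => i _; rewrite /acodim; set k := \rank _.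
  rewrite -(big_mkord (fun j => true && (k <= j)%N) (fun=> 1%N)).
  by rewrite -(big_nat_widenl k 0 r xpredT) // sum_nat_const_nat muln1.
have injL : injective Lam.
  (* Both dimensions are r (#E + 1) + #E: the lengths count as #E unknowns in the source, and the
     codimensions contribute r + #E to the target. *)
  apply: (linear_surj_inj linL surjL); rewrite /dim /= /dim /= cardS rigid_acyclic.
  rewrite -[dim 'rV[R]_r]/(1 * r)%N -[dim R^o]/1%N; ring.
move=> He Hi v; have /boolp.choice [l lP] := He.
have : Lam ([ffun v => H v], [ffun e => l e]) = Lam 0.
  congr pair; apply/ffunP => k; rewrite !ffunE /=.
    by rewrite lP !subrr scale0r subr0.
  rewrite mul0mx [RHS]mxE; case: k => -[i j] /= ij.
  by have /submx_coord -> := Hi i.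
by move/injL => [/ffunP /(_ v)]; rewrite !ffunE.
Qed.

Lemma rigid_W e b n : W_edge A s c e b n <-> branch A e b (toR R n).
Proof.
exact: (W_edgeP rigid_conn rigid_acyclic rigid_curve rigid_matches rigid_psi).
Qed.

(** Deformations of the two sides with the same [x] glue across [e], their ends differing by a
    multiple of u_E. The result vanishes by [rigid_ker], and only the slide along [e] remains. *)
Lemma rigid_meet e x : branch A e false x -> branch A e true x ->
  exists t : R, x = t *: toR R (uedge e).
Proof.
move=> [H0 [e0 i0] [t0 x0]] [H1 [e1 i1] [t1 x1]].
pose H v := if v \in side e true then H1 v else H0 v.
have H0E v : v \in side e false -> H v = H0 v.
  by move/(side_disjoint rigid_conn rigid_acyclic); rewrite /H => /negbTE ->.
have H1E v : v \in side e true -> H v = H1 v by rewrite /H => ->.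
have HE : forall e', exists l : R, H (tend e' true) - H (tend e' false) = l *: toR R (uedge e').
  move=> e'; have [->|ne] := eqVneq e' e.
    exists (t0 - t1); rewrite H1E ?H0E ?tend_side // scalerBl.
    have /rowP E : H1 (tend e true) + t1 *: toR R (uedge e) =
        H0 (tend e false) + t0 *: toR R (uedge e).
      by rewrite -x0 -x1.
    by apply/rowP => j; have := E j; rewrite !mxE; lra.
  have [[] fb] := side_cover rigid_conn e (tend e' false);
    have tb := side_edge ne fb; rewrite /= in tb.
    by rewrite !H1E //; apply: e1.
  by rewrite !H0E //; apply: e0.
have HI i : (H (tleg T i) <= toR R (adir (A i)))%MS.
  have [[] ib] := side_cover rigid_conn e (tleg T i).
    by rewrite H1E //; apply: i1.
  by rewrite H0E //; apply: i0.
exists t1; rewrite x1 -H1E ?tend_side //.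
by rewrite (rigid_ker HE HI) add0r.
Qed.

(** * Gluing at a vertex and torsion of the cokernel of Phi *)

Definition flag_space (f : flag T) (x : 'rV[R]_r) : Prop :=
  match f with
  | inl (e, b) => branch A e (~~ b) x
  | inr i => (x <= toR R (adir (A i)))%MS
  end.

(** The side consists of its root and the disjoint far sides of the other edges at the root.
    Deformations of these, all compatible with displacing the root by [x], glue to one of the whole
    side. *)
Lemma branch_glue e b x :
  (forall f, fvert f = tend e b -> f != inl (e, b) -> flag_space f x) -> branch A e b x.
Proof.
set v0 := tend e b => Fx.
have /boolp.choice [h hP] : forall p : tedge T * bool, exists H : tvert T -> 'rV[R]_r,
    tend p.1 p.2 = v0 -> p != (e, b) -> flex A (side p.1 (~~ p.2)) H /\
      exists t : R, x = H (tend p.1 (~~ p.2)) + t *: toR R (uedge p.1).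
  move=> [e' b']; have [[ev nf]|no] := pselect (tend e' b' = v0 /\ (e', b') != (e, b)); last first.
    by exists (fun=> 0) => ev nf; case: no.
  by have [H fH xH] := Fx (inl (e', b')) ev nf; exists H.
pose H v := if v == v0 then x else
  oapp (fun p => h p v) 0
    [pick p : tedge T * bool | (tend p.1 p.2 == v0) && (v \in side p.1 (~~ p.2))].
have Hv0 : H v0 = x by rewrite /H eqxx.
(* The far sides are disjoint, so the choice made by [pick] is forced. *)
have HE e' b' v : tend e' b' = v0 -> v \in side e' (~~ b') -> H v = h (e', b') v.
  move=> ev vs; rewrite /H; case: eqP => [vv0|_].
    by have := side_bridge rigid_conn rigid_acyclic e' (~~ b'); rewrite negbK ev -vv0 vs.
  case: pickP => [[e2 b2] /= /andP[/eqP ev2 vs2]|/(_ (e', b'))]; last by rewrite /= ev vs eqxx.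
  have [->//|nf] := eqVneq (e2, b2) (e', b').
  have /fintype.subsetP /(_ v vs2) := side_sub rigid_conn rigid_acyclic (etrans ev2 (esym ev)) nf.
  by move/(side_disjoint rigid_conn rigid_acyclic); rewrite vs.
have nf e' b' v : v \in side e b -> v \in side e' (~~ b') -> (e', b') != (e, b).
  move=> vb; apply: contraTneq => -[-> ->].
  exact: (side_disjoint rigid_conn rigid_acyclic vb).
exists H; last by exists 0; rewrite Hv0 scale0r addr0.
split=> [e' s0 s1|i ib].
  (* An edge at the root is handled by the relation between [x] and the far end; any other edge lies
     inside a single branch. *)
  have [eF|nF] := eqVneq v0 (tend e' false).
    have [_ [t xE]] := hP (e', false) (esym eF) (nf e' false _ s1 (tend_side e' true)).
    exists (- t); rewrite -eF Hv0 [X in _ - X]xE (HE e' false) ?tend_side //.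
    by rewrite opprD addrA subrr add0r scaleNr.
  have [eT|nT] := eqVneq v0 (tend e' true).
    have [_ [t xE]] := hP (e', true) (esym eT) (nf e' true _ s0 (tend_side e' false)).
    by exists t; rewrite -eT Hv0 [X in X - _]xE (HE e' true) ?tend_side // addrAC subrr add0r.
  have [e2 [b2 [ev2 f2]]] := branch_cover rigid_conn rigid_acyclic nF.
  have ne : e' != e2.
    by apply: contraTneq isT => ee; move: nF nT; rewrite ee -ev2; case: (b2); rewrite eqxx.
  have t2 := side_edge ne f2; rewrite /= in t2.
  rewrite !(HE e2 b2) //.
  by have [[fe _] _] := hP (e2, b2) ev2 (nf _ _ _ s0 f2); apply: fe.
have [iv|ni] := eqVneq v0 (tleg T i).
  by rewrite -iv Hv0; apply: (Fx (inr i)).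
have [e2 [b2 [ev2 i2]]] := branch_cover rigid_conn rigid_acyclic ni.
rewrite (HE e2 b2) //.
by have [[_ fi] _] := hP (e2, b2) ev2 (nf _ _ _ ib i2); apply: fi.
Qed.

Lemma rigid_edge e n :
  lat_span (edge_image c e) n <-> exists t : R, toR R n = t *: toR R (uedge e).
Proof.
rewrite -[lat_span _ _]/(lin_span (edge_image c e) (toR R n)).
have [l0 cE] := rigid_curve e; set l := (c.2 e : R) in l0 cE.
split=> [|[t ->]].
  apply: (lin_span_min (P := fun x => exists t : R, x = t *: toR R (uedge e))).
  - by exists 0; rewrite scale0r.
  - by move=> a _ _ [t ->] [t' ->]; exists (a * t + t'); rewrite scalerA scalerDl.
  - move=> _ _ [t _ ->] [t' _ ->]; exists ((t - t') * l); rewrite cE.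
    by apply/rowP => j; rewrite !mxE; ring.
have -> : t *: toR R (uedge e) = (t / l) *: (c.1 (tend e true) - c.1 (tend e false)).
  by rewrite cE addrAC subrr add0r scalerA divfK ?gt_eqF.
apply: lin_span_diff; [exists 1|exists 0]; rewrite ?lexx ?ler01 ?subrr ?subr0 //.
  by rewrite scale0r scale1r add0r.
by rewrite scale0r scale1r addr0.
Qed.

(** A real solution from [rigid_surj] is made integral by an additive map applied to its entries;
    the equations survive because their coefficients are integers. *)
Lemma rigid_torsion (z : tedge T + I -> 'rV[int]_r) :
  exists2 m, (0 < m)%N & exists H : tvert T -> 'rV[int]_r,
    (forall e, lat_span (edge_image c e) (z (inl e) *+ m - Phi H (inl e))) /\
    (forall i, lat_span (aset (A i)) (z (inr i) *+ m - Phi H (inr i))).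
Proof.
have [H [He Hi]] := rigid_surj (fun e => toR R (z (inl e))) (fun i => toR R (z (inr i))).
have [rho [rhoD rho1]] := rational_retraction R.
have [m m0 [y yP]] := common_denominator (fun k : tvert T * 'I_r => rho (H k.1 0 k.2)).
(* The retraction followed by the common denominator: [sig] multiplies integers by [m] and sends the
   entries of [H] to integers. *)
pose sig (x : R) : R := ratr (rho x) * m%:R.
have sigB : {morph sig : x x' / x - x'}.
  move=> x x'; apply/eqP; rewrite /sig eq_sym subr_eq -mulrDl -rmorphD.
  by rewrite -rhoD subrK.
pose Sig : {additive R -> R} := HB.pack sig (GRing.isZmodMorphism.Build _ _ sig sigB).
have SigMz x k : Sig (x * k%:~R) = Sig x * k%:~R.
  by rewrite !mulrzr raddfMz.
exists m => //; exists (fun v => \row_j y (v, j)).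
have SigH v : toR R (\row_j y (v, j)) = map_mx Sig (H v).
  apply/rowP => j; rewrite !mxE /= /sig -[m%:R](ratr_nat R m) -rmorphM.
  by rewrite (yP (v, j)) rmorph_int.
have Sigz n : map_mx Sig (toR R n) = toR R (n *+ m) :> 'rV_r.
  apply/rowP => j; rewrite toR_Mn mulmxnE !mxE.
  by rewrite -[_%:~R]mul1r SigMz /= /sig rho1 rmorph1 !mul1r mulr_natl.
split=> [e|i].
  apply/rigid_edge; have [l lE] := He e; exists (- Sig l).
  have := congr1 (map_mx Sig) lE; rewrite !map_mxB /= Sigz -!SigH.
  move=> E; rewrite toRB [toR R (_ - _)]toRB -opprB E scaleNr; congr (- _).
  by apply/rowP => j; rewrite !mxE; apply: SigMz.
apply/lin_span_aset; have /submxP [w wE] := Hi i.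
have := congr1 (map_mx Sig) wE; rewrite map_mxB Sigz -SigH => E.
rewrite toRB -opprB E.
have -> : map_mx Sig (w *m toR R (adir (A i))) = map_mx Sig w *m toR R (adir (A i)).
  apply/rowP => j; rewrite !mxE raddf_sum; apply: eq_bigr => k _.
  by rewrite !mxE; apply: SigMz.
by rewrite -mulNmx submxMl.
Qed.

(** * Comparison of the indices *)

Local Notation W := (W_edge A s c).
Local Notation K := (W_flag A s c).

Lemma subgroup_W e b : subgroup (W e b).
Proof.
exact: (subgroup_W_edge rigid_conn rigid_acyclic rigid_curve rigid_matches rigid_psi).
Qed.

Lemma subgroup_K (f : flag T) : subgroup (K f).
Proof. by case: f => [[e b]|i] /=; [apply: subgroup_W|apply: subgroup_lat_span]. Qed.

Definition D_lattice (j : tedge T + I) : set 'rV[int]_r :=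
  match j with
  | inl e => lat_span (edge_image c e)
  | inr i => lat_span (aset (A i))
  end.

Lemma PhiB : {morph @Phi r I T : H H' / H - H'}.
Proof.
move=> H H'; apply/funext => -[e|i] //=.
by rewrite [RHS]fct_subE /= !fct_subE; apply/rowP => j; rewrite !mxE; ring.
Qed.

Lemma subgroup_Phi : subgroup (image_plus (@Phi r I T) D_lattice).
Proof.
apply: subgroup_image_plus PhiB _ => -[e|i]; exact: subgroup_lat_span.
Qed.

Lemma indexed_Phi : exists n, indexed (image_plus (@Phi r I T) D_lattice) n.
Proof.
apply: indexed_lattice subgroup_Phi _ => z; have [m m0 [H [He Hi]]] := rigid_torsion z.
by exists m => //; exists H => -[e|i]; rewrite natmulfctE; [apply: He|apply: Hi].
Qed.

Lemma W_edge_lattice e n : W e false n -> W e true n -> lat_span (edge_image c e) n.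
Proof. by move=> /rigid_W B0 /rigid_W B1; apply/rigid_edge/rigid_meet. Qed.

Lemma edge_lattice_W e b n : lat_span (edge_image c e) n -> W e b n.
Proof. by move=> /rigid_edge [t nE]; apply/rigid_W; rewrite nE; apply: branch_edge. Qed.

Lemma subgroup_mult_edge e :
  subgroup (image_plus (fun (n : 'rV[int]_r) (_ : bool) => n) (W e)).
Proof. by apply: subgroup_image_plus => // b; apply: subgroup_W. Qed.

(** Prescribe the difference of [y] across [e] and zero at all other edges and legs. A solution [H]
    for a multiple restricts to a deformation of each side, so its values at the ends of [e] lie in
    the lattices W. *)
Lemma indexed_mult_edge e :
  exists n, indexed (image_plus (fun (n : 'rV[int]_r) (_ : bool) => n) (W e)) n.
Proof.
apply: indexed_lattice (subgroup_mult_edge e) _ => y.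
pose z (j : tedge T + I) := if j == inl e then y true - y false else 0.
have [m m0 [H [He Hi]]] := rigid_torsion z.
have WH b : W e b (H (tend e b)).
  apply/rigid_W; exists (fun v => toR R (H v)); last by exists 0; rewrite scale0r addr0.
  split=> [e' e0 e1|i ib].
    have := He e'; rewrite /z (_ : inl e' == inl e = false) ?mul0rn ?sub0r.
      by move/(subgroupN (subgroup_lat_span _)); rewrite opprK => /rigid_edge; rewrite /= toRB.
    by apply/negbTE; have := side_inner rigid_conn rigid_acyclic e0 e1.
  have := Hi i; rewrite /z /= mul0rn sub0r.
  by move/(subgroupN (subgroup_lat_span _)); rewrite opprK => /lin_span_aset.
(* The remainder is then [H (tend e false)] at the false end and, modulo L_N(E), [H (tend e true)]
   at the true end. *)
exists m => //; exists (y false *+ m - H (tend e false)) => b; rewrite natmulfctE.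
case: b; last by rewrite subKr.
have := edge_lattice_W true (He e); rewrite /z eqxx /=.
move=> /(subgroupD (subgroup_W e true)) /(_ (WH true)).
by congr (W e true); rewrite mulrnBl -!addrA; apply/rowP => j; rewrite !mxE; ring.
Qed.

(* Interpolates between Theta ([l] empty) and Psi ([l] full). *)
Definition mixed (l : seq (tedge T * bool)) (H : tvert T -> 'rV[int]_r) (f : flag T) :
    'rV[int]_r :=
  match f with
  | inl (e, b) => H (tend e b) - (if (e, b) \in l then 0 else H (tend e (~~ b)))
  | inr i => H (tleg T i)
  end.

Lemma mixedB l : {morph mixed l : H H' / H - H'}.
Proof.
move=> H H'; apply/funext => -[[e b]|i] //=; rewrite [RHS]fct_subE /= !fct_subE.
by case: ifP => _; apply/rowP => j; rewrite !mxE; ring.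
Qed.

Lemma subgroup_mixed l : subgroup (image_plus (mixed l) K).
Proof. by apply: subgroup_image_plus; [apply: mixedB | apply: subgroup_K]. Qed.

(** The excluded flag sits at the near end of [e], so every flag condition on the far side is
    available; [branch_glue] combines those at one vertex. *)
Lemma mixed_zero l H e b :
  (forall f, f != inl (e, b) -> K f (mixed l H f)) -> W e (~~ b) (H (tend e (~~ b))).
Proof.
move=> HK.
(* Induction from the leaves: at the end of a side all other flags point outwards. *)
suff main k e' b' : (#|side e' b'| < k)%N -> tend e b \notin side e' b' -> W e' b' (H (tend e' b')).
  apply: main (ltnSn _) _; have := side_bridge rigid_conn rigid_acyclic e (~~ b).
  by rewrite negbK.
elim: k e' b' => // k IHk e' b' le_k out.
apply/rigid_W/branch_glue => f fv nf.
have nfk : f != inl (e, b).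
  apply: contraNneq out => fE; rewrite fE /= in fv.
  by rewrite fv tend_side.
have {nfk} := HK f nfk; case: f fv nf => [[e2 b2]|i] /= fv nf; last first.
  by rewrite fv => /lin_span_aset.
rewrite fv => Wm; apply/rigid_W.
(* Either [H] at the vertex is itself in W, or it differs by an element of W from its value at the
   far end, which the induction covers. *)
case: ifP Wm => _; rewrite ?subr0 // => Wm.
rewrite -[H _](subrK (H (tend e2 (~~ b2)))); apply: (subgroupD (subgroup_W _ _)) => //.
apply: IHk.
  by apply: leq_trans (side_card rigid_conn rigid_acyclic fv nf) _.
by apply: contra out; apply: (fintype.subsetP (side_sub rigid_conn rigid_acyclic fv nf)).
Qed.

Lemma indexed_mixed l n :
  indexed (image_plus (mixed [::]) K) n -> indexed (image_plus (mixed l) K) n.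
Proof.
move=> ind0; elim: l => // -[e b] l IHl.
apply: (indexed_swap (mixedB l) (mixedB _) subgroup_K _ _ IHl (k := inl (e, b))).
  move=> H [[e' b']|i] //= nf; rewrite inE (_ : (e', b') == (e, b) = false) //.
  exact/negbTE.
move=> H HK; rewrite /= inE eqxx /= subr0.
case: ifP => _; first by rewrite subr0 subrr; apply: (subgroup0 (subgroup_W _ _)).
rewrite addrAC subrr add0r; apply: (subgroupN (subgroup_W _ _)).
exact: mixed_zero HK.
Qed.

(** Phi followed by [g] is Theta. The preimage under [g] is the lattice of Phi because the two W of
    an edge meet in L_N(E); what remains modulo the image of [g] splits into the cokernels defining
    Mult(E). *)
Lemma D_mult_edges (n : tedge T -> nat) d :
  (forall e, indexed (image_plus (fun (n : 'rV[int]_r) (_ : bool) => n) (W e)) (n e)) ->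
  indexed (image_plus (@Phi r I T) D_lattice) d ->
  indexed (image_plus (mixed [::]) K) ((\prod_e n e) * d).
Proof.
move=> ne nd.
pose g (z : tedge T + I -> 'rV[int]_r) (f : flag T) := match f with
  | inl (e, b) => if b then z (inl e) else - z (inl e) | inr i => z (inr i) end.
have gB : {morph g : x y / x - y}.
  move=> x y; apply/funext => -[[e b]|i] //=; rewrite [RHS]fct_subE /=.
  by case: b; rewrite fct_subE // opprB opprK addrC.
have gPhi H : g (Phi H) = mixed [::] H.
  by apply/funext => -[[e b]|i] //=; case: b; rewrite ?opprB.
(* The labels are exchanged because the flag at one end carries the W of the other; the sign makes
   the image of [g] diagonal. *)
pose rho e (y : flag T -> 'rV[int]_r) (b : bool) :=
  if b then - y (inl (e, false)) else y (inl (e, true)).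
have rhoB e : {morph rho e : x y / x - y}.
  move=> x y; apply/funext => b; rewrite [RHS]fct_subE /rho.
  by case: b; rewrite fct_subE // opprB opprK addrC.
apply: (indexed_comp gB (subgroup_mixed _)).
  rewrite (_ : g @^-1` _ = image_plus (@Phi r I T) D_lattice) //.
  apply/seteqP; split=> z [H HP]; exists H.
    have {}HP f : K f (g (z - Phi H) f) by rewrite gB gPhi; apply: HP.
    case=> [e|i]; last exact: (HP (inr i)).
    apply: W_edge_lattice; first exact: (HP (inl (e, true))).
    by rewrite -[_ - _]opprK; apply: (subgroupN (subgroup_W _ _)) (HP (inl (e, false))).
  have {}HP j : D_lattice j ((z - Phi H) j) by apply: HP.
  move=> f; rewrite -[X in K f X]/((g z - mixed [::] H) f) -gPhi -gB.
  case: f => [[e []]|i] /=; [|apply: (subgroupN (subgroup_W _ _))|exact: (HP (inr i))].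
    by apply: edge_lattice_W; apply: (HP (inl e)).
  by apply: edge_lattice_W; apply: (HP (inl e)).
rewrite (_ : [set y | _] = [set y | forall e, image_plus (fun n _ => n) (W e) (rho e y)]).
  apply: (indexed_prod (rho := rho) rhoB _ ne) => w.
  exists (fun f => match f with inl (e, b) => if b then w e false else - w e true | inr i => 0 end).
  by move=> e; apply/funext => -[]; rewrite /rho ?opprK.
apply/seteqP; split=> y.
  move=> [z [H HP]] e; exists (z (inl e) + Phi H (inl e)) => b.
  have := HP (inl (e, ~~ b)); rewrite fct_subE /= negbK /rho; case: b => /=.
    move/(subgroupN (subgroup_W _ _)); congr (W e true _).
    by apply/rowP => j; rewrite !mxE; ring.
  congr (W e false _); by apply/rowP => j; rewrite !mxE; ring.
(* Leg coordinates are attained exactly by [g], so they contribute nothing to the index. *)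
move=> /boolp.choice [k kP]; pose z (j : tedge T + I) := match j with
  inl e => k e | inr i => y (inr i) end.
exists z, 0; case=> [[e b]|i]; rewrite fct_subE /=; last first.
  by rewrite subrr subr0; apply: (subgroup0 (subgroup_lat_span _)).
rewrite !subr0; have := kP e (~~ b); rewrite /rho; case: b => //=.
move/(subgroupN (subgroup_W _ _)); congr (W e true _).
by apply/rowP => j; rewrite !mxE; ring.
Qed.

(** With every flag listed, [mixed] is Psi, whose conditions decouple vertex by vertex; the product
    formula follows by uniqueness of the index. *)
Lemma mult_vertices d :
  indexed (image_plus (mixed [::]) K) d ->
  exists2 n : tvert T -> nat, d = (\prod_v n v)%N &
    forall v, indexed (image_plus (fun (n : 'rV[int]_r) (_ : {f : flag T | fvert f == v}) => n)
              (fun f => K (val f))) (n v).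
Proof.
have mixE : mixed (enum {: tedge T * bool}) = fun H f => H (fvert f).
  apply/funext => H; apply/funext => -[[e b]|i] //=.
  by rewrite mem_enum subr0.
pose rho v (y : flag T -> 'rV[int]_r) (f : {f : flag T | fvert f == v}) := y (val f).
have glue (w : forall v, {f : flag T | fvert f == v} -> 'rV[int]_r) :
    exists y, forall v, rho v y = w v.
  exists (fun f => w _ (exist _ f (eqxx (fvert f)))) => v; apply/funext => -[f fv].
  rewrite /rho /=; have E := eqP fv; case: _ / E fv => fv.
  by congr (w _ _); apply/val_inj.
pose Kv v (f : {f : flag T | fvert f == v}) := K (val f).
have gv v : subgroup (image_plus (fun (n : 'rV[int]_r) _ => n) (Kv v)).
  by apply: subgroup_image_plus => // f; apply: subgroup_K.
pose Sv v := image_plus (fun (n : 'rV[int]_r) _ => n) (Kv v).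
have splitE : image_plus (fun H f => H (fvert f)) K =
    [set y | forall v, image_plus (fun n _ => n) (Kv v) (rho v y)].
  apply/seteqP; split=> y.
    by move=> [H HP] v; exists (H v) => -[f fv]; have := HP f; rewrite (eqP fv).
  by move=> /boolp.choice [H HP]; exists H => f; apply: (HP _ (exist _ f (eqxx _))).
move=> /(indexed_mixed (enum {: tedge T * bool})); rewrite mixE => dP.
have /boolp.choice [n nP] : forall v, exists n,
    indexed (image_plus (fun (n : 'rV[int]_r) _ => n) (Kv v)) n.
  move=> v; rewrite splitE in dP.
  apply: (indexed_factor (S := Sv) (a := v) (rho := rho) _ _ (gv v) dP) => // w.
  by exists (fun f => oapp w 0 (insub f)); apply/funext => f; rewrite /rho valK.
exists n => //; apply: (indexed_uniq _ dP).
  by apply: subgroup_image_plus => //; apply: subgroup_K.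
by rewrite splitE; apply: (indexed_prod (rho := rho) (S := Sv)).
Qed.

End Rigid.

Theorem corollary4p5 (R : realType) (r : nat) (I : finType)
    (A : I -> rat_affine R r) (s : I -> nat)
    (T : trop_type r I) (c : config R T)
    (hgenus : genus T = 0%N) (hrigid : rigid A s c) :
  [/\ (0 < D_index A c)%N,
      (forall v : tvert T, (0 < mult_vertex A s c v)%N),
      (forall e : tedge T, (0 < mult_edge A s c e)%N) &
      (D_index A c)%:R =
        (\prod_(v : tvert T) (mult_vertex A s c v)%:R) /
        (\prod_(e : tedge T) (mult_edge A s c e)%:R) :> rat].
Proof.
have [d dP] := indexed_Phi hgenus hrigid.
have /boolp.choice [ne neP] := indexed_mult_edge hgenus hrigid.
have [nv prodE nvP] := mult_vertices hgenus hrigid (D_mult_edges hgenus hrigid neP dP).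
have -> : D_index A c = d by apply: indexed_coker (subgroup_Phi A c) dP.
have eE e : mult_edge A s c e = ne e.
  by apply: indexed_coker (subgroup_mult_edge hgenus hrigid e) (neP e).
have vE v : mult_vertex A s c v = nv v.
  apply: indexed_coker (nvP v); apply: subgroup_image_plus => // f.
  exact: (subgroup_K hgenus hrigid).
have ne0 e : (0 < ne e)%N by apply: indexed_gt0 (neP e).
split=> [|v|e|]; rewrite ?eE ?vE //.
- exact: indexed_gt0 dP.
- exact: indexed_gt0 (nvP v).
under eq_bigr => v _ do rewrite vE.
under [X in _ / X]eq_bigr => e _ do rewrite eE.
rewrite -!natr_prod -prodE natrM mulrAC mulfV ?mul1r //.
by rewrite pnatr_eq0 -lt0n prodn_gt0.
Qed.
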